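(* Let $d\ge 2$ and let $C_d\subset\mathbb{P}^d$ be the rational normal curve of degree $d$. For any integer $\ell\ge1$, the singular locus of the variety of $\ell$-secants $\mathrm{Sec}^\ell(C_d)\subset\mathrm{Gr}(d-1,d+1)$ is $$\mathrm{Sing}(\mathrm{Sec}^\ell(C_d))=\mathrm{Sec}^{\ell+1}(C_d).$$
   Context: $\mathrm{Gr}(d-1,d+1)$ is the Grassmannian of $(d-1)$-dimensional linear subspaces of $\mathbb{C}^{d+1}$, viewed also as codimension-2 linear subspaces of $\mathbb{P}^d$. $C_d$ is the image of $\mathbb{P}^1\to\mathbb{P}^d$, $[s:t]\mapsto[s^d:s^{d-1}t:\dots:t^d]$. For $V\in\mathrm{Gr}(d-1,d+1)$ let $D_V=\sum_{p\in C_d}m_p\,p$ be the effective divisor on $C_d$ where $m_p$ is the smallest order of vanishing at $p$ of (the restriction to $C_d$ of) any linear form vanishing on $V$; $\deg D_V=\sum_p m_p$. The variety of $\ell$-secants is $\mathrm{Sec}^\ell(C_d)=\{V\in\mathrm{Gr}(d-1,d+1):\deg D_V\ge\ell\}$ with its reduced structure (so it is empty for $\ell>d-1$, and $\mathrm{Sec}^1(C_d)$ is the Chow hypersurface of $C_d$). $\mathrm{Sing}(X)$ denotes the singular locus of the variety $X$. *)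

(* Defs.v *)
From HB Require Import structures.
From mathcomp Require Import all_boot all_order all_algebra.
From mathcomp Require Import boolp classical_sets fsbigop.
From mathcomp Require Import mpoly.

Set Implicit Arguments.
Unset Strict Implicit.
Unset Printing Implicit Defensive.

Import GRing.Theory.
Local Open Scope classical_set_scope.
Local Open Scope ring_scope.

(* A point of the affine space A^n over F is a row vector x : 'rV[F]_n, with
   coordinates x ord0 : 'I_n -> F. Varieties are sets of closed points, with
   their reduced structure; this is meant for F algebraically closed. *)
Section AffineVarieties.
Variables (F : fieldType) (n : nat).
Implicit Types (X Y Z : set 'rV[F]_n) (x : 'rV[F]_n).

Definition zero_locus (S : set {mpoly F[n]}) : set 'rV[F]_n :=
  [set x | forall f, S f -> f.@[x ord0] = 0].

Definition vanishing_ideal X : set {mpoly F[n]} :=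
  [set f | forall x, X x -> f.@[x ord0] = 0].

(* Z is a closed subset of X for the Zariski topology induced on X. *)
Definition closed_in X Z := exists S, Z = X `&` zero_locus S.

Definition irreducible_closed_in X Z :=
  [/\ closed_in X Z, Z !=set0 &
      forall Y1 Y2, closed_in X Y1 -> closed_in X Y2 ->
        Z `<=` Y1 `|` Y2 -> Z `<=` Y1 \/ Z `<=` Y2].

(* The Krull dimension of the local ring of X at x: its chains of prime ideals
   correspond to the chains Z 0 < Z 1 < ... < Z r of irreducible closed subsets
   of X that contain x. The lengths of these chains are bounded by n, so that
   the supremum is a maximum when x is a point of X. *)
Definition local_dim X x : nat :=
  supremum 0%N [set r | exists Z : nat -> set 'rV[F]_n,
    [/\ forall i, (i <= r)%N -> irreducible_closed_in X (Z i) /\ Z i x &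
        forall i, (i < r)%N -> Z i `<` Z i.+1]].

(* The common zero set of the differentials at x of the f in the ideal of X. *)
Definition in_tangent X x (v : 'rV[F]_n) :=
  forall f, vanishing_ideal X f ->
    \sum_(i < n) v ord0 i * (f^`M(i)).@[x ord0] = 0.

Definition tangent_space X x : {vspace 'rV[F]_n} :=
  xget 0%VS [set T : {vspace 'rV[F]_n} | forall v, v \in T <-> in_tangent X x v].

Lemma mem_tangent_space X x v : v \in tangent_space X x <-> in_tangent X x v.
Proof.
rewrite /tangent_space.
suff: [set T : {vspace 'rV[F]_n} | forall v, v \in T <-> in_tangent X x v] !=set0.
  by move=> /(xgetPex 0%VS); exact.
pose P k := `[< exists U : {vspace 'rV[F]_n},
  \dim U = k /\ forall v, v \in U -> in_tangent X x v >].
have P0 : exists k, P k.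
  exists 0%N; apply/asboolP; exists 0%VS; split; first by rewrite dimv0.
  move=> w; rewrite memv0 => /eqP -> f _.
  by rewrite big1 // => i _; rewrite mxE mul0r.
have Pn k : P k -> (k <= n)%N.
  by move=> /asboolP[U [<- _]]; rewrite (leq_trans (dimvS (subvf U))) // dimvf /dim /= mul1n.
case: (ex_maxnP P0 Pn) => k /asboolP[U [dU UT]] maxk.
exists U => w; split => [/UT //|wT].
have /(dimv_leqif_sup) : (U <= U + <[w]>)%VS by exact: addvSl.
move=> [_]; rewrite dU => dimE.
have : P (\dim (U + <[w]>)).
  apply/asboolP; exists (U + <[w]>)%VS; split=> // y /memv_addP[u uU [z /vlineP[c ->] ->]] f fX.
  have := UT _ uU f fX; have := wT f fX => hw hu.
  under eq_bigr => i _ do rewrite !mxE mulrDl -mulrA.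
  by rewrite big_split /= hu -mulr_sumr hw mulr0 addr0.
move=> /maxk dle.
have sub : (U + <[w]> <= U)%VS.
  by rewrite -dimE eqn_leq dle -{1}dU dimvS ?addvSl.
by rewrite memvE; apply: subv_trans (addvSr _ _) sub.
Qed.

(* The local ring of X at x is not regular. *)
Definition affine_singular X x :=
  X x /\ \dim (tangent_space X x) <> local_dim X x.

End AffineVarieties.

Section Grassmannian.
Variable F : fieldType.

Definition Gr k n : set {vspace 'rV[F]_n} := [set V | \dim V = k].

(* The standard charts A^(k * (n - k)) -> Gr k n: p and q enumerate
   complementary subsets of the standard basis e of F^n, and the matrix A is
   sent to the span of the vectors e_(p i) + \sum_j A i j e_(q j); it is the
   row space of a matrix whose k x k block of columns p is the identity. *)
Definition chart_index k n (p : 'I_k -> 'I_n) (q : 'I_(n - k) -> 'I_n) :=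
  bijective (fun i : 'I_k + 'I_(n - k) =>
               match i with inl i => p i | inr j => q j end).

Definition chart k n (p : 'I_k -> 'I_n) (q : 'I_(n - k) -> 'I_n)
    (x : 'rV[F]_(k * (n - k))) : {vspace 'rV[F]_n} :=
  (\sum_(i < k) <[delta_mx ord0 (p i) +
      \sum_(j < n - k) vec_mx x i j *: delta_mx ord0 (q j)]>)%VS.

(* The singular locus of a subvariety X of Gr k n; the choice of the chart
   around V is immaterial. *)
Definition Sing k n (X : set {vspace 'rV[F]_n}) : set {vspace 'rV[F]_n} :=
  [set V | exists (p : 'I_k -> 'I_n) (q : 'I_(n - k) -> 'I_n)
                  (x : 'rV[F]_(k * (n - k))),
     [/\ chart_index p q, chart p q x = V &
         affine_singular (chart p q @^-1` X) x]].

End Grassmannian.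

Arguments Gr F k n : clear implicits.
Arguments Sing {F} k n X.

(* Points of P^d are the elements of Gr F 1 d.+1. *)
Section RationalNormalCurve.
Variables (F : fieldType) (d : nat).

Definition veronese (A : comNzRingType) (s t : A) : 'rV[A]_d.+1 :=
  \row_i (s ^+ (d - i) * t ^+ i).

Definition rnc_point (u : 'rV[F]_2) : {vspace 'rV[F]_d.+1} :=
  <[veronese (u ord0 ord0) (u ord0 ord_max)]>%VS.

Definition rational_normal_curve : set {vspace 'rV[F]_d.+1} :=
  [set rnc_point u | u in [set u | u != 0]].

Definition linear_form := 'Hom('rV[F]_d.+1, F^o).

(* The restriction of phi to C_d near rnc_point u, in terms of the local
   parameter z = 'X given by z |-> rnc_point (u + z w), for u and w linearly
   independent; its order at z = 0 depends only on phi and rnc_point u. *)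
Definition local_equation (phi : linear_form) (u w : 'rV[F]_2) : {poly F} :=
  \sum_(i < d.+1) phi (delta_mx ord0 i) *:
    veronese ((u ord0 ord0)%:P + w ord0 ord0 *: 'X)
             ((u ord0 ord_max)%:P + w ord0 ord_max *: 'X) ord0 i.

(* phi (nonzero) vanishes to order m at the point P of C_d. *)
Definition vanishing_order (phi : linear_form) (P : {vspace 'rV[F]_d.+1})
    (m : nat) :=
  exists u w : 'rV[F]_2,
    [/\ free [:: u; w], P = rnc_point u & m = mup 0 (local_equation phi u w)].

(* The zero form vanishes to infinite order, hence is left out. *)
Definition divisor_mult (V P : {vspace 'rV[F]_d.+1}) : nat :=
  infimum 0%N [set m | exists phi : linear_form,
    [/\ phi != 0, (V <= lker phi)%VS & vanishing_order phi P m]].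

Definition divisor_degree (V : {vspace 'rV[F]_d.+1}) : nat :=
  \sum_(P \in rational_normal_curve) divisor_mult V P.

Definition Sec (l : nat) : set {vspace 'rV[F]_d.+1} :=
  [set V | Gr F d.-1 d.+1 V /\ (l <= divisor_degree V)%N].

End RationalNormalCurve.

Arguments rational_normal_curve F d : clear implicits.
Arguments Sec F d l : clear implicits.

(* Main.v *)
(* A codimension 2 subspace V is cut out by a pencil of binary forms (f, g) of degree d, and
   deg D_V is the degree of gcd(f, g); hence V lies in Sec^l if and only if (f, g) = h (a, b)
   with deg h = l and deg a = deg b = m := d - l. Let X be the trace of Sec^l on a chart,
   an affine space of dimension N = 2 (d - 1).

   - The local dimension of X is at most N - l everywhere. Indeed X is covered by finitely many
     rational parametrisations (h, a, b) |-> (h a, h b) with N - l parameters, and a chain of r + 1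
     irreducible closed subsets yields r functions whose monomials are linearly independent
     on X, so that counting monomials of bounded degree gives r <= N - l.
   - If gcd(f, g) = h has degree exactly l, a chain of length N - l through (f, g) is given by
     affine subspaces of {h (a, b)}, of dimension 2 (m - 1), followed by the closures of the loci where
     the common divisor contains a given divisor of h of degree l - 1, ..., 1, 0. The tangent
     space is { (u, v) : h divides b u - a v }: one inclusion comes from the curves
     (h + t w) (a + t a', b + t b'), the other one from the minors of the map
     (a', b') |-> a' f + b' g, which drops rank exactly on X. It has dimension N - l.
   - If gcd(f, g) has a divisor h of degree l + 1, the tangent space is everything.
     When h has distinct roots r_i, it contains the vectors (h / (X - r_i)) (u, v), which
     span by Lagrange interpolation; the general case follows by continuity. *)

From HB Require Import structures.
Require Import Defs.
From mathcomp Require Import all_boot all_order all_algebra.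
From mathcomp Require Import boolp classical_sets fsbigop reals complex.
From mathcomp Require Import mpoly ring zify.

Set Implicit Arguments.
Unset Strict Implicit.
Unset Printing Implicit Defensive.

Import GRing.Theory.
Local Open Scope classical_set_scope.
Local Open Scope ring_scope.

(** [Sing] refers to the full ideal of a reduced set, for which no generators are at hand. So
    tangent vectors are produced from velocities of rational curves inside the set, and constrained
    by a polynomial shown to vanish at every point of the set. Curves also replace morphisms: a set
    any two of whose points are joined by a rational curve has an irreducible closure, and an
    identity that holds along a curve off finitely many parameters holds wherever the curve is
    defined. To stay within polynomials, a curve is a tuple of numerators over one denominator; for
    pencils of forms the denominator is the 2 x 2 minor [chart_pivot], by which a pair is brought to
    reduced echelon form. The dimension enters unevenly: at a point with a larger common divisor the
    upper bound N - l suffices, since l is positive; the exact value is needed only where the common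
    divisor has degree l. With m + 1 in place of m, N - l equals l + 2 m: l coefficients of h up to
    scaling, and 2 (m + 2) - 4 for (a, b) modulo GL_2. *)

Lemma mpoly_closed_ind (R : comNzRingType) (n : nat) (P : {mpoly R[n]} -> Prop) :
  (forall c, P c%:MP) -> (forall i, P 'X_i) ->
  (forall f g, P f -> P g -> P (f + g)) ->
  (forall f g, P f -> P g -> P (f * g)) -> forall f, P f.
Proof.
move=> PC PX PD PM; elim/mpolyind => [|c m p _ _ Pp]; first by rewrite -mpolyC0.
apply: (PD) => //; rewrite -mul_mpolyC; apply: (PM) => //; rewrite mpolyXE_id.
apply: (big_ind P) => [||i _]; [by rewrite -mpolyC1 | exact: PM |].
by elim: (m i) => [|k IH]; rewrite ?expr0 ?exprS -?mpolyC1; [| apply: (PM)].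
Qed.

(** * Rational curves: velocities, limits, irreducibility *)

Section RationalCurves.
Variables (F : closedFieldType) (n : nat).
Implicit Types (f : {mpoly F[n]}) (N : 'I_n -> {poly F}) (D : {poly F}).

(** Clearing of denominators in [f (N / D)]. The ring [A] is arbitrary because both [{poly F}], for
    curves, and [{mpoly F[s]}], for parametrisations, are needed. *)
Lemma homogenize (A : comNzRingType) (iota : {rmorphism F -> A})
    (N : 'I_n -> A) (D : A) f :
  exists (k : nat) (g : A), forall ev : {rmorphism A -> F},
    cancel iota ev -> ev D != 0 ->
    ev g = ev D ^+ k * f.@[fun i => ev (N i) / ev D].
Proof.
elim/mpoly_closed_ind: f => [c|i|f1 f2 [k1 [g1 H1]] [k2 [g2 H2]]|
    f1 f2 [k1 [g1 H1]] [k2 [g2 H2]]].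
- by exists 0%N, (iota c) => ev evK _; rewrite expr0 mul1r mevalC evK.
- exists 1%N, (N i) => ev _ Dt; rewrite expr1 mevalXU; by field.
- exists (k1 + k2)%N, (g1 * D ^+ k2 + g2 * D ^+ k1) => ev evK Dt.
  by rewrite mevalD rmorphD !rmorphM !rmorphXn H1 // H2 // exprD; ring.
- exists (k1 + k2)%N, (g1 * g2) => ev evK Dt.
  by rewrite mevalM rmorphM H1 // H2 // exprD; ring.
Qed.

(** The derivative is the quotient rule for [D ^+ k * f (N / D)] at [D.[0] = 1]. It is carried
    through the induction that builds [g], so that rational functions never occur as objects. *)
Lemma homogenize_curve N D f : D.[0] = 1 ->
  exists (k : nat) (g : {poly F}),
    (forall t, D.[t] != 0 ->
       g.[t] = D.[t] ^+ k * f.@[fun i => (N i).[t] / D.[t]]) /\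
    g^`().[0] = D^`().[0] *+ k * f.@[fun i => (N i).[0]] +
      \sum_i ((N i)^`().[0] - D^`().[0] * (N i).[0]) *
        (f^`M(i)).@[fun i => (N i).[0]].
Proof.
move=> D0; have D0n : D.[0] != 0 by rewrite D0 oner_neq0.
have sumD (a b : 'I_n -> F) : \sum_i (a i + b i) = \sum_i a i + \sum_i b i.
  by rewrite big_split.
have ev0 f1 k1 (g1 : {poly F}) :
    (forall t, D.[t] != 0 ->
       g1.[t] = D.[t] ^+ k1 * f1.@[fun i => (N i).[t] / D.[t]]) ->
    g1.[0] = f1.@[fun i => (N i).[0]].
  move=> H; rewrite H // D0 expr1n mul1r; apply: meval_eq => i.
  by rewrite divr1.
have dD k : (D ^+ k)^`().[0] = D^`().[0] *+ k.
  by rewrite deriv_exp hornerMn hornerM horner_exp D0 expr1n mulr1.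
elim/mpoly_closed_ind: f => [c|i|f1 f2 [k1 [g1 [H1 d1]]] [k2 [g2 [H2 d2]]]|
    f1 f2 [k1 [g1 [H1 d1]]] [k2 [g2 [H2 d2]]]].
- exists 0%N, c%:P; split=> [t _|]; first by rewrite expr0 mul1r !mevalC hornerC.
  rewrite derivC horner0 mulr0n mul0r add0r big1 // => i _.
  by rewrite mderivC meval0 mulr0.
- exists 1%N, (N i); split=> [t Dt|]; first by rewrite expr1 mevalXU; field.
  rewrite mevalXU mulr1n (bigD1 i) //= big1 => [|j ji].
    rewrite mderivX mnm1E eqxx scale1r.
    have -> : (U_(i) - U_(i) = 0 :> 'X_{1.. n})%MM.
      by apply/mnmP => j; rewrite mnmBE subnn mnm0E.
    by rewrite mpolyX0 meval1; ring.
  by rewrite mderivX mnm1E eq_sym (negPf ji) scale0r meval0 mulr0.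
- exists (k1 + k2)%N, (g1 * D ^+ k2 + g2 * D ^+ k1); split=> [t Dt|].
    by rewrite !(mevalD, hornerE) H1 // H2 // exprD; ring.
  under eq_bigr => i _ do rewrite mderivD mevalD mulrDr.
  rewrite sumD derivD !derivM !hornerE !dD d1 d2 mevalD.
  by rewrite (ev0 _ _ _ H1) (ev0 _ _ _ H2) D0 !expr1n mulrnDr /=; ring.
- exists (k1 + k2)%N, (g1 * g2); split=> [t Dt|].
    by rewrite mevalM hornerM H1 // H2 // exprD; ring.
  under eq_bigr => i _ do
    rewrite mderivM mevalD !mevalM mulrDr mulrA [_ * (f1.@[_] * _)]mulrCA.
  rewrite sumD -mulr_suml -mulr_sumr derivM !hornerE d1 d2 mevalM.
  by rewrite (ev0 _ _ _ H1) (ev0 _ _ _ H2) mulrnDr /=; ring.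
Qed.

Lemma horner_eq0 (p : {poly F}) : (forall t, p.[t] = 0) -> p = 0.
Proof.
by move=> p0; apply/eqP; apply/negPn/closed_nonrootP => -[t]; rewrite rootE p0 eqxx.
Qed.

Definition curve_at N D (t : F) : 'rV[F]_n := \row_i ((N i).[t] / D.[t]).

Lemma curve_atE f N D t :
  f.@[curve_at N D t ord0] = f.@[fun i => (N i).[t] / D.[t]].
Proof. by apply: meval_eq => i; rewrite mxE. Qed.

Lemma homogenize_curve_at f N D : exists (k : nat) (g : {poly F}),
  forall t, D.[t] != 0 -> g.[t] = D.[t] ^+ k * f.@[curve_at N D t ord0].
Proof.
have [k [g Hg]] := homogenize polyC N D f; exists k, g => t Dt.
by rewrite curve_atE; apply: (Hg (horner_eval t)) => // c; apply: hornerC.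
Qed.

(** The pullback of an [f] in the ideal, cleared of denominators, vanishes off the roots of [D],
    hence is the zero polynomial; its derivative at 0 is the required relation. *)
Lemma curve_tangent (X : set 'rV[F]_n) (x : 'rV[F]_n) N D :
  D.[0] = 1 -> (forall i, (N i).[0] = x ord0 i) ->
  (forall t, D.[t] != 0 -> X (curve_at N D t)) ->
  in_tangent X x (\row_i ((N i)^`().[0] - D^`().[0] * x ord0 i)).
Proof.
move=> D0 N0 NX f fX.
have [k [g [Hg dg]]] := homogenize_curve N f D0.
have fx : f.@[fun i => (N i).[0]] = 0.
  have /fX : X (curve_at N D 0) by apply: NX; rewrite D0 oner_neq0.
  by rewrite curve_atE D0; apply: etrans; apply: meval_eq => i; rewrite divr1.
have g0 : g = 0.
  have : g * D = 0.
    apply: horner_eq0 => t; rewrite hornerM; have [->|Dt] := eqVneq D.[t] 0.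
      by rewrite mulr0.
    by rewrite Hg // -curve_atE fX ?mulr0 ?mul0r //; apply: NX.
  move/eqP; rewrite mulf_eq0 => /orP[/eqP //|/eqP D_0].
  by move: D0; rewrite D_0 horner0 => /eqP; rewrite eq_sym oner_eq0.
move: dg; rewrite g0 deriv0 horner0 fx mulr0 add0r => /esym dg.
rewrite -[RHS]dg; apply: eq_bigr => i _; rewrite mxE N0.
by congr (_ * _); apply: meval_eq => j; rewrite N0.
Qed.

(** The Zariski form of a limit argument: the roots of [E] are the bad parameters, and 0 may be one
    of them. *)
Lemma curve_closed f N D (E : {poly F}) : D.[0] != 0 -> E != 0 ->
  (forall t, E.[t] != 0 -> D.[t] != 0 -> f.@[curve_at N D t ord0] = 0) ->
  f.@[curve_at N D 0 ord0] = 0.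
Proof.
move=> D0 E0 fN.
have [k [g Hg]] := homogenize_curve_at f N D.
have g0 : g = 0.
  have : g * (D * E) = 0.
    apply: horner_eq0 => t; rewrite !hornerM.
    have [->|Dt] := eqVneq D.[t] 0; first by rewrite mul0r mulr0.
    have [->|Et] := eqVneq E.[t] 0; first by rewrite !mulr0.
    by rewrite Hg // fN // mulr0 mul0r.
  move/eqP; rewrite !mulf_eq0 (negPf E0) orbF => /orP[/eqP //|/eqP D_0].
  by move: D0; rewrite D_0 horner0 eqxx.
move: (Hg 0 D0); rewrite g0 horner0.
move/esym/eqP; rewrite mulf_eq0 expf_eq0 => /orP[/andP[_]|/eqP //].
by rewrite (negPf D0).
Qed.

(** Irreducibility of the closure, put in terms of the ideal so that parametrised sets qualify
    without being shown closed. *)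
Definition prime_set (Y : set 'rV[F]_n) := Y !=set0 /\
  forall f g, vanishing_ideal Y (f * g) ->
    vanishing_ideal Y f \/ vanishing_ideal Y g.

(** If [f] is nonzero at [y1] and [g] at [y2], their pullbacks to a curve joining [y1] to [y2] are
    nonzero polynomials, and so is the product. *)
Lemma curve_connected_prime (Y : set 'rV[F]_n) : Y !=set0 ->
  (forall y1 y2, Y y1 -> Y y2 -> exists N D,
     [/\ D.[0] != 0, D.[1] != 0, curve_at N D 0 = y1, curve_at N D 1 = y2 &
         forall t, D.[t] != 0 -> Y (curve_at N D t)]) ->
  prime_set Y.
Proof.
move=> Y0 YY; split=> // f g fg.
apply: contrapT => /not_orP[/existsNP[y1 /not_implyP[Y1 f1]] /existsNP[y2 /not_implyP[Y2 g2]]].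
have [N [D [D0 D1 E1 E2 NY]]] := YY _ _ Y1 Y2.
have [kf [f' hf]] := homogenize_curve_at f N D.
have [kg [g' hg]] := homogenize_curve_at g N D.
have : f' * g' * D = 0.
  apply: horner_eq0 => t; rewrite !hornerM; have [->|Dt] := eqVneq D.[t] 0.
    by rewrite mulr0.
  rewrite hf // hg // mulrACA -mevalM fg ?mulr0 ?mul0r //; exact: NY.
move/eqP; rewrite !mulf_eq0 => /orP[/orP[]|] /eqP z.
- move: (hf 0 D0); rewrite z horner0 E1 => /esym/eqP.
  by rewrite mulf_eq0 expf_eq0 (negPf D0) andbF /= => /eqP.
- move: (hg 1 D1); rewrite z horner0 E2 => /esym/eqP.
  by rewrite mulf_eq0 expf_eq0 (negPf D1) andbF /= => /eqP.
- by move: D0; rewrite z horner0 eqxx.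
Qed.

End RationalCurves.

(** * Chains of irreducible closed subsets *)

Section LocalDimension.
Variables (F : closedFieldType) (n : nat).
Implicit Types (f g : {mpoly F[n]}) (X Y Z : set 'rV[F]_n) (x y : 'rV[F]_n).

Lemma closure_irreducible X Y : Y `<=` X -> prime_set Y ->
  irreducible_closed_in X (X `&` zero_locus (vanishing_ideal Y)).
Proof.
move=> YX [[y Yy] pY]; split; first by exists (vanishing_ideal Y).
  by exists y; split; [apply: YX | move=> f; apply].
move=> Y1 Y2 [S1 ->] [S2 ->] sub; apply: contrapT => /not_orP[].
move=> /existsNP[z1 /not_implyP[[Xz1 cz1] n1]] /existsNP[z2 /not_implyP[[Xz2 cz2] n2]].
have [f1 S1f f1z] : exists2 f, S1 f & f.@[z1 ord0] <> 0.
  apply: contrapT => H; apply: n1; split=> // f Sf; apply: contrapT => fz.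
  by apply: H; exists f.
have [f2 S2f f2z] : exists2 f, S2 f & f.@[z2 ord0] <> 0.
  apply: contrapT => H; apply: n2; split=> // f Sf; apply: contrapT => fz.
  by apply: H; exists f.
have : vanishing_ideal Y (f1 * f2).
  move=> u Yu; have /sub : (X `&` zero_locus (vanishing_ideal Y)) u.
    by split; [apply: YX | move=> f; apply].
  by rewrite mevalM => -[[_ /(_ _ S1f) ->]|[_ /(_ _ S2f) ->]]; rewrite ?mul0r ?mulr0.
by case/pY => [/cz1|/cz2].
Qed.

Lemma irreducible_closed_prime X Z : irreducible_closed_in X Z -> prime_set Z.
Proof.
move=> [[S ZS] Z0 irr]; split=> // f g fg.
have cl h : closed_in X (X `&` zero_locus [set h]) by exists [set h].
have [|H|H] := irr _ _ (cl f) (cl g).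
- move=> z Zz; have := fg z Zz; rewrite mevalM => /eqP; rewrite mulf_eq0.
  have Xz : X z by move: Zz; rewrite ZS => -[].
  by move=> /orP[] /eqP e; [left|right]; split=> // h ->.
- by left=> z /H[_]; apply.
- by right=> z /H[_]; apply.
Qed.

Lemma nat_supremumE (A : set nat) m : A m -> (forall k, A k -> (k <= m)%N) ->
  supremum 0%N A = m.
Proof.
move=> Am ub; rewrite /supremum; case: eqP => [A0|_]; first by move: Am; rewrite A0.
have mS : supremums A m by split=> [k /ub //|k]; apply.
have [p1 p2] := xgetPex 0%N (ex_intro _ m mS).
by apply/eqP; rewrite eqn_leq (p2 m ub : _ <= m)%N (p1 m Am : m <= _)%N.
Qed.

Lemma nat_supremum_le (A : set nat) m : (forall k, A k -> (k <= m)%N) ->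
  (supremum 0%N A <= m)%N.
Proof.
move=> ub; rewrite /supremum; case: eqP => // _.
by case: xgetP => // k _ [_]; apply.
Qed.

Lemma nat_infimumE (A : set nat) m : A m -> (forall k, A k -> (m <= k)%N) ->
  infimum 0%N A = m.
Proof.
move=> Am lb; rewrite /infimum; case: eqP => [A0|_]; first by move: Am; rewrite A0.
have mS : infimums A m by split=> [k /lb //|k]; apply.
have [p1 p2] := xgetPex 0%N (ex_intro _ m mS).
by apply/eqP; rewrite eqn_leq (p2 m lb : m <= _)%N (p1 m Am : _ <= m)%N.
Qed.

(** The set inside [local_dim], named so that its upper and lower bounds can be stated
    separately. *)
Definition chain_lengths X x : set nat :=
  [set r | exists Z : nat -> set 'rV[F]_n,
    [/\ forall i, (i <= r)%N -> irreducible_closed_in X (Z i) /\ Z i x &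
        forall i, (i < r)%N -> Z i `<` Z i.+1]].

(** The chain consists of the closures in [X] of the [Y i]; the function [f] keeps consecutive
    closures apart. *)
Lemma flag_chain X x (Y : nat -> set 'rV[F]_n) (r : nat) : Y 0 x ->
  (forall i, (i <= r)%N -> Y i `<=` X /\ prime_set (Y i)) ->
  (forall i, (i < r)%N -> Y i `<=` Y i.+1 /\
     exists2 f, vanishing_ideal (Y i) f & ~ vanishing_ideal (Y i.+1) f) ->
  chain_lengths X x r.
Proof.
move=> Yx YX Yf; exists (fun i => X `&` zero_locus (vanishing_ideal (Y i))); split.
  move=> i ir; have [YiX pY] := YX i ir.
  split; first exact: closure_irreducible.
  have Yix : Y i x.
    by elim: i ir {YiX pY} => // i IH ir; apply: (Yf i ir).1; apply: IH; lia.
  by split; [apply: YiX | move=> f; apply].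
move=> i ir; have [YY [f fY fY1]] := Yf i ir; split.
  move=> z [Xz Yz]; split=> // g gY; apply: Yz => u Yu; apply: gY; exact: YY.
move=> H; apply: fY1 => z Yz.
have [] : (X `&` zero_locus (vanishing_ideal (Y i))) z.
  apply: H; split; last by move=> g; apply.
  by apply: (YX i.+1 ir).1.
by move=> _; apply.
Qed.

End LocalDimension.

(** * Upper bound on chains by counting monomials *)

Section DimensionBound.
Variables (F : closedFieldType) (n : nat).
Implicit Types (f : {mpoly F[n]}) (g : nat -> {mpoly F[n]}) (X Z : set 'rV[F]_n).

Definition independent_on Z (g : nat -> {mpoly F[n]}) (M : nat) :=
  forall c : nat -> F, vanishing_ideal Z (\sum_(a < M) c a *: g a) ->
    forall a, (a < M)%N -> c a = 0.

(** On [Z] only the term [b = 0] survives, so its coefficients vanish; the remaining sum is [f]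
    times a shorter one, and [f] can be cancelled because [Z'] is prime. *)
Lemma independent_on_powers Z Z' f g M : Z `<=` Z' -> prime_set Z' ->
  vanishing_ideal Z f -> ~ vanishing_ideal Z' f -> independent_on Z g M ->
  forall (B : nat) (c : nat -> nat -> F),
  vanishing_ideal Z' (\sum_(b < B) f ^+ b * \sum_(a < M) c b a *: g a) ->
  forall b a, (b < B)%N -> (a < M)%N -> c b a = 0.
Proof.
move=> ZZ [_ pZ'] fZ fZ' gZ; elim=> // B IH c.
rewrite big_ord_recl expr0 mul1r.
have -> : \sum_(i < B) f ^+ lift ord0 i * \sum_(a < M) c (lift ord0 i) a *: g a =
    f * \sum_(b < B) f ^+ b * \sum_(a < M) c b.+1 a *: g a.
  by rewrite mulr_sumr; apply: eq_bigr => b _; rewrite lift0 exprS mulrA.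
move=> H; have c0 a : (a < M)%N -> c 0%N a = 0.
  apply: gZ => z Zz; have := H z (ZZ z Zz).
  by rewrite mevalD mevalM (fZ z Zz) mul0r addr0.
case=> [|b] a bB aM; first exact: c0.
apply: (IH (fun b => c b.+1)) => //.
suff /pZ'[//|//] : vanishing_ideal Z' (f * \sum_(b < B) f ^+ b * \sum_(a < M) c b.+1 a *: g a).
move=> z /H; rewrite [X in X + _]big1 ?add0r // => i _.
by rewrite c0 // scale0r.
Qed.

Lemma sum_ord_mul (V : nmodType) (m k : nat) (G : nat -> V) :
  \sum_(i < m * k) G i = \sum_(b < k) \sum_(a < m) G (a * k + b)%N.
Proof.
rewrite exchange_big /=; elim: m => [|m IH]; first by rewrite mul0n !big_ord0.
rewrite big_ord_recr /= -IH -(big_mkord xpredT G) mulSn addnC.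
rewrite (@big_cat_nat _ _ _ (m * k)) //= ?leq_addr // big_mkord; congr (_ + _).
by rewrite -{1}[(m * k)%N]add0n big_addn addKn big_mkord; apply: eq_bigr => i _; rewrite addnC.
Qed.

Lemma independent_on_step Z Z' f g M k : (0 < k)%N -> Z `<=` Z' -> prime_set Z' ->
  vanishing_ideal Z f -> ~ vanishing_ideal Z' f -> independent_on Z g M ->
  independent_on Z' (fun i => g (i %/ k)%N * f ^+ (i %% k)) (M * k).
Proof.
move=> k0 ZZ pZ' fZ fZ' gZ c.
rewrite [X in vanishing_ideal _ X]
  (sum_ord_mul M k (fun i => c i *: (g (i %/ k)%N * f ^+ (i %% k)))) => H a aMk.
have := @independent_on_powers _ _ _ _ _ ZZ pZ' fZ fZ' gZ k (fun b a => c (a * k + b)%N) _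
  (a %% k)%N (a %/ k)%N.
rewrite -divn_eq; apply; last 2 first.
- by rewrite ltn_mod.
- by rewrite ltn_divLR.
move=> z /H <-; congr meval; apply: eq_bigr => b _; rewrite mulr_sumr; apply: eq_bigr => j _.
by rewrite divnMDl // divn_small // addn0 modnMDl modn_small // mulrC scalerAl.
Qed.

(* The exponents are the digits of [a] in base [k]. *)
Fixpoint digit_monomial (A : pzRingType) (f : nat -> A) (k i a : nat) : A :=
  if i is i'.+1 then digit_monomial f k i' (a %/ k) * f i' ^+ (a %% k) else 1.

(** [f i] vanishes on [Z i] but not on [Z i.+1]. The functions are chosen before [k], so that their
    degrees stay fixed while [k] grows. *)
Lemma chain_independent X x r : chain_lengths X x r ->
  exists f : nat -> {mpoly F[n]}, forall k, (0 < k)%N ->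
    independent_on X (digit_monomial f k r) (k ^ r).
Proof.
move=> [Z [irrZ ltZ]].
have /choice[f Hf] i : exists f, (i < r)%N -> vanishing_ideal (Z i) f /\ ~ vanishing_ideal (Z i.+1) f.
  case: (boolP (i < r)%N) => ir; last by exists 0.
  have [[[S ZS] _ _] _] := irrZ i (ltnW ir).
  have [ZZ /existsNP[z /not_implyP[zZ zN]]] := ltZ i ir.
  suff [g Sg gz] : exists2 g, S g & g.@[z ord0] <> 0.
    by exists g => _; split=> [u|/(_ z zZ)//]; rewrite ZS => -[_]; apply.
  apply: contrapT => H; apply: zN; rewrite ZS; split.
    by have [[[S' ZS'] _ _] _] := irrZ i.+1 ir; move: zZ; rewrite ZS' => -[].
  by move=> g Sg; apply: contrapT => gz; apply: H; exists g.
exists f => k k0.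
have ZX : Z r `<=` X by have [[[S ->] _ _] _] := irrZ r (leqnn r); move=> z [].
suff H i : (i <= r)%N -> independent_on (Z i) (digit_monomial f k i) (k ^ i).
  by move=> c cX; apply: (H r (leqnn r)) => z /ZX; apply: cX.
elim: i => [_ c|i IH ir].
  have [[_ [z Zz] _] _] := irrZ 0%N isT.
  by move=> /(_ z Zz); rewrite expn0 big_ord1 mevalZ meval1 mulr1 => c0 [].
rewrite expnSr; apply: independent_on_step (IH (ltnW ir)) => //; try by apply Hf.
- by apply: (ltZ i ir).1.
- by apply: irreducible_closed_prime; apply: (irrZ i.+1 ir).1.
Qed.

End DimensionBound.

Section Counting.
Variables (F : closedFieldType) (s : nat).
Implicit Types p q : {mpoly F[s]}.

Lemma deg_leM p q a b : (msize p <= a.+1)%N -> (msize q <= b.+1)%N ->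
  (msize (p * q) <= (a + b).+1)%N.
Proof.
have [->|p0] := eqVneq p 0; first by rewrite mul0r msize0.
have [->|q0] := eqVneq q 0; first by rewrite mulr0 msize0.
by rewrite msizeM //; move: (msize p) (msize q) => u v; lia.
Qed.

Lemma deg_leX p a k : (msize p <= a.+1)%N -> (msize (p ^+ k) <= (a * k).+1)%N.
Proof.
move=> pa; elim: k => [|k IH]; first by rewrite expr0 -mpolyC1 msizeC; case: eqP.
by rewrite exprS mulnS; apply: deg_leM.
Qed.

Lemma mpoly_small_eq0 p L : (msize p <= L)%N ->
  (forall m : {ffun 'I_s -> 'I_L}, p@_[multinom nat_of_ord (m i) | i < s] = 0) -> p = 0.
Proof.
move=> pL H; apply/mpolyP => m; rewrite mcoeff0.
have [mL|mL] := ltnP (mdeg m) L; last first.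
  by apply/eqP; rewrite -[_ == 0]negbK -mcoeff_msupp; apply: msize_mdeg_ge; apply: leq_trans mL.
have miL i : (m i < L)%N by apply: leq_ltn_trans mL; rewrite mdegE (bigD1 i) //= leq_addr.
rewrite -(H [ffun i => Ordinal (miL i)]); congr mcoeff; apply/mnmP => i.
by rewrite mnmE ffunE.
Qed.

(** One relation has to serve all [j] at once: [M] unknowns against [#|J| * L ^ s] equations, one
    for each coefficient. *)
Lemma many_mpoly_dependent (J : finType) (M L : nat) (G : J -> nat -> {mpoly F[s]}) :
  (forall j a, (a < M)%N -> msize (G j a) <= L)%N -> (#|J| * L ^ s < M)%N ->
  exists c : nat -> F, (exists2 a, (a < M)%N & c a <> 0) /\
    forall j, \sum_(a < M) c a *: G j a = 0.
Proof.
move=> GL card.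
pose T := (J * {ffun 'I_s -> 'I_L})%type.
pose A : 'M[F]_(M, #|{: T}|) := \matrix_(a, b)
  let jm : T := enum_val b in
  (G jm.1 a)@_[multinom nat_of_ord (jm.2 i) | i < s].
have : kermx A != 0.
  rewrite kermx_eq0 -row_leq_rank -ltnNge; apply: leq_ltn_trans (rank_leq_col A) _.
  by rewrite card_prod card_ffun !card_ord.
case/rowV0Pn => u /sub_kermxP uA u0.
exists (fun a => if insub a is Some i then u ord0 i else 0); split.
  have [i ui] : exists i, u ord0 i != 0.
    apply/existsP; rewrite -negb_forall; apply: contra u0 => /forallP H.
    by apply/eqP/rowP => i; rewrite mxE; apply/eqP.
  by exists i => //; rewrite valK; apply/eqP.
move=> j; apply: (@mpoly_small_eq0 _ L) => [|m].
  elim/big_ind: _ => [||a _]; first by rewrite msize0.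
    by move=> p q pL qL; apply: leq_trans (msizeD_le _ _) _; rewrite geq_max pL.
  by apply: leq_trans (msizeZ_le _ _) _; apply: GL.
have /rowP/(_ (enum_rank ((j, m) : T))) := uA.
rewrite !mxE => H; rewrite -[RHS]H raddf_sum /=; apply: eq_bigr => a _.
by rewrite valK mcoeffZ mxE enum_rankK.
Qed.

End Counting.

Section DimensionBoundTheorem.
Variables (F : closedFieldType) (n s : nat) (J : finType).

(* If [r] were larger than [s], the [k ^ r] monomials in the functions of
   [chain_independent] would outnumber, for large [k], the coefficients of their
   pullbacks, polynomials in [s] variables whose degrees are linear in [k]. *)
Lemma chain_length_bound (X : set 'rV[F]_n) x (r : nat)
    (N : J -> 'I_n -> {mpoly F[s]}) (D : J -> {mpoly F[s]}) :
  (forall y, X y -> exists j t, (D j).@[t] != 0 /\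
     y = \row_i ((N j i).@[t] / (D j).@[t])) ->
  chain_lengths X x r -> (r <= s)%N.
Proof.
move=> cover /chain_independent[f indf]; rewrite leqNgt; apply/negP => sr.
have /choice[ge Hge] (ji : J * nat) : exists ge : {mpoly F[s]} * {mpoly F[s]},
    forall t : 'I_s -> F, (D ji.1).@[t] != 0 -> ge.2.@[t] != 0 /\
    ge.1.@[t] = ge.2.@[t] *
      (f ji.2).@[(\row_i ((N ji.1 i).@[t] / (D ji.1).@[t])) ord0].
  have [k [g Hg]] := homogenize (@mpolyC s F) (N ji.1) (D ji.1) (f ji.2).
  exists (g, D ji.1 ^+ k) => t Dt; rewrite /= rmorphXn /= expf_neq0 //; split=> //.
  rewrite (Hg (meval t) (mevalC t) Dt); congr (_ * _).
  by apply: meval_eq => i; rewrite mxE.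
have [g [e Hge']] : exists g e : J -> nat -> {mpoly F[s]}, forall j i t,
    (D j).@[t] != 0 -> (e j i).@[t] != 0 /\
    (g j i).@[t] = (e j i).@[t] * (f i).@[(\row_i ((N j i).@[t] / (D j).@[t])) ord0].
  by exists (fun j i => (ge (j, i)).1), (fun j i => (ge (j, i)).2) => j i t; apply: (Hge (j, i)).
pose E := \max_j \max_(i < r) (msize (g j i) + msize (e j i)).
have gE j i : (i < r)%N -> (msize (g j i) <= E.+1)%N && (msize (e j i) <= E.+1)%N.
  move=> ir; have : (msize (g j i) + msize (e j i) <= E)%N.
    apply: leq_trans (leq_bigmax j).
    exact: (@leq_bigmax _ (fun i : 'I_r => msize (g j i) + msize (e j i))%N (Ordinal ir)).
  by move=> H; apply/andP; split; lia.
(* As [s < r], [k ^ r] is at least [k ^ s * k], which has to exceed the count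
   [#|J| * ((r * E + 1) * k) ^ s]. *)
have [k k0 Hk] : exists2 k, (0 < k)%N & (#|J| * (r * E + 1) ^ s < k)%N.
  by exists (#|J| * (r * E + 1) ^ s).+1.
(* Each factor is padded to the full power [k] of its denominator whatever the digit is. The nonzero
   factor [w] below is then the same for all [a], and a relation among the [G j r a] descends to the
   monomials. *)
pose G := fix G j i a := if i is i'.+1 then
  G j i' (a %/ k)%N * (g j i' ^+ (a %% k) * e j i' ^+ (k - a %% k)) else 1 : {mpoly F[s]}.
have Gsize j i a : (i <= r)%N -> (msize (G j i a) <= (i * (E * k)).+1)%N.
  elim: i a => [|i IH] a ir /=; first by rewrite -mpolyC1 msizeC; case: eqP.
  have /andP[g1 e1] := gE j i ir.
  have -> : (i.+1 * (E * k) = i * (E * k) + (E * (a %% k) + E * (k - a %% k)))%N.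
    by rewrite -mulnDr subnKC 1?ltnW ?ltn_mod // mulSn addnC.
  by apply: deg_leM; [apply: IH; apply: ltnW | apply: deg_leM; apply: deg_leX].
have Geval j t i : (D j).@[t] != 0 -> exists2 w, w != 0 & forall a,
    (G j i a).@[t] = w * (digit_monomial f k i a).@[(\row_i ((N j i).@[t] / (D j).@[t])) ord0].
  move=> Dt; elim: i => [|i [w w0 IH]].
    by exists 1 => [|a]; rewrite ?oner_neq0 //= !meval1 mulr1.
  have [e0 gE'] := Hge' j i t Dt.
  exists (w * (e j i).@[t] ^+ k) => [|a /=]; first by rewrite mulf_neq0 // expf_neq0.
  rewrite !mevalM IH !(rmorphXn (meval _)) /= gE'.
  have -> : (e j i).@[t] ^+ k = (e j i).@[t] ^+ (a %% k) * (e j i).@[t] ^+ (k - a %% k).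
    by rewrite -exprD subnKC // ltnW // ltn_mod.
  by rewrite exprMn; ring.
have [||c [[a ak ca] Hc]] := @many_mpoly_dependent F s J (k ^ r) (r * (E * k)).+1 (fun j => G j r).
- by move=> j a _; apply: Gsize.
- have H : ((r * (E * k)).+1 <= (r * E + 1) * k)%N.
    by rewrite mulnDl mul1n mulnA -addn1 leq_add2l.
  apply: leq_ltn_trans (_ : #|J| * ((r * E + 1) * k) ^ s < _)%N.
    rewrite leq_mul2l; apply/orP; right.
    by have [->|s0] := posnP s; rewrite ?expn0 // leq_exp2r.
  rewrite expnMn mulnA; apply: (@leq_trans (k ^ s.+1)).
    by rewrite expnS ltn_pmul2r // expn_gt0 k0.
  by rewrite leq_pexp2l.
apply: ca; apply: (indf k _ c _ a ak) => // y /cover[j [t [Dt ->]]].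
have [w w0 Hw] := Geval j t r Dt.
have /(congr1 (meval t)) := Hc j; rewrite meval0 !raddf_sum /= => H.
apply: (mulfI w0); rewrite mulr0 -[RHS]H mulr_sumr; apply: eq_bigr => b _.
by rewrite !mevalZ Hw; ring.
Qed.

End DimensionBoundTheorem.

(** * Points of a chart as reduced pencils of polynomials *)

Section ChartForms.
Variables (d : nat) (p : 'I_d.-1 -> 'I_d.+1) (q : 'I_(d.+1 - d.-1) -> 'I_d.+1).

Definition two_forms (hd : (2 <= d)%N) : 2 = (d.+1 - d.-1)%N.
Proof. lia. Defined.

Hypothesis hd : (2 <= d)%N.
Hypothesis pq : chart_index p q.

Definition q0 : 'I_(d.+1 - d.-1) := cast_ord (two_forms hd) ord0.
Definition q1 : 'I_(d.+1 - d.-1) := cast_ord (two_forms hd) ord_max.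

Lemma q01 j : j = q0 \/ j = q1.
Proof.
have : (j < 2)%N by rewrite [ltnRHS](two_forms hd).
by case e: (j : nat) => [|[|]] // _; [left|right]; apply: val_inj; rewrite /= e.
Qed.

Lemma q10 : (q1 == q0) = false. Proof. by []. Qed.

Lemma chart_q_inj : injective q.
Proof.
move=> j1 j2 e; have /bij_inj inj := pq.
by have [] : inr j1 = inr j2 :> 'I_d.-1 + _ by apply: inj.
Qed.

Lemma chart_p_inj : injective p.
Proof.
move=> j1 j2 e; have /bij_inj inj := pq.
by have [] : inl j1 = inl j2 :> _ + 'I_(d.+1 - d.-1) by apply: inj.
Qed.

Lemma chart_pq_neq i j : p i != q j.
Proof.
apply/eqP => e; have /bij_inj inj := pq.
by have : inl i = inr j by apply: inj.
Qed.

Lemma chart_index_cases (P : 'I_d.+1 -> Prop) :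
  (forall i, P (p i)) -> P (q q0) -> P (q q1) -> forall i, P i.
Proof.
move=> Pp P0 P1 i; have [g _ gK] := pq.
by rewrite -(gK i); case: (g i) => [//|j]; have [->|->] := q01 j.
Qed.

Section Generic.
Variable A : comNzRingType.
Implicit Types (y : 'rV[A]_(d.-1 * (d.+1 - d.-1))) (f g : {poly A}).

(* The linear forms [chart_form y q0] and [chart_form y q1] cut out the subspace [chart p q y];
   a form of degree [d] in [s] and [t] is a polynomial in [t / s] of size at most [d.+1]. *)
Definition chart_form y j : {poly A} := 'X^(q j) - \sum_i vec_mx y i j *: 'X^(p i).

Lemma size_form y j : (size (chart_form y j) <= d.+1)%N.
Proof.
apply: leq_trans (size_polyD _ _) _; rewrite geq_max size_polyN size_polyXn ltn_ord /=.
apply: leq_trans (size_sum _ _ _) _; apply/bigmax_leqP => i _.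
by apply: leq_trans (size_scale_leq _ _) _; rewrite size_polyXn.
Qed.

Lemma coef_form_q y j j' : (chart_form y j)`_(q j') = (j == j')%:R.
Proof.
rewrite coefB coefXn coef_sum big1 ?subr0 => [|i _].
  by rewrite eq_sym (inj_eq val_inj) (inj_eq chart_q_inj).
by rewrite coefZ coefXn eq_sym (inj_eq val_inj) (negPf (chart_pq_neq _ _)) mulr0.
Qed.

Lemma coef_form_p y j i : (chart_form y j)`_(p i) = - vec_mx y i j.
Proof.
rewrite coefB coefXn (inj_eq val_inj) (negPf (chart_pq_neq _ _)) sub0r coef_sum.
rewrite (bigD1 i) //= coefZ coefXn eqxx mulr1 big1 ?addr0 // => i' ii'.
by rewrite coefZ coefXn (inj_eq val_inj) (inj_eq chart_p_inj) eq_sym (negPf ii') mulr0.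
Qed.

Lemma chart_poly_eq f g : (size f <= d.+1)%N -> (size g <= d.+1)%N ->
  (forall i, f`_(p i) = g`_(p i)) -> f`_(q q0) = g`_(q q0) ->
  f`_(q q1) = g`_(q q1) -> f = g.
Proof.
move=> sf sg Hp H0 H1; apply/polyP => i; have [ilt|ige] := ltnP i d.+1; last first.
  by rewrite !nth_default //; apply: leq_trans ige.
by rewrite -[(i)]/(nat_of_ord (Ordinal ilt)); elim/chart_index_cases: (Ordinal ilt).
Qed.

(** The minor of the pencil in the columns [q]; it is nonzero when the pencil belongs to the
    chart. *)
Definition chart_pivot f g : A := f`_(q q0) * g`_(q q1) - f`_(q q1) * g`_(q q0).

(** Cramer's rule for reducing the pencil to the identity in the columns [q], before division by the
    pivot, so that it makes sense over polynomial rings. The sign is that of the coefficients of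
    [chart_form] at [p i]. *)
Definition chart_numer f g : 'rV[A]_(d.-1 * (d.+1 - d.-1)) :=
  mxvec (\matrix_(i, j) - (if j == q0 then g`_(q q1) * f`_(p i) - f`_(q q1) * g`_(p i)
                           else f`_(q q0) * g`_(p i) - g`_(q q0) * f`_(p i))).

End Generic.

Lemma map_form (A B : comNzRingType) (ev : {rmorphism A -> B}) y j :
  map_poly ev (chart_form y j) = chart_form (map_mx ev y) j.
Proof.
rewrite /chart_form rmorphB /= map_polyXn rmorph_sum /=; congr (_ - _).
by apply: eq_bigr => i _; rewrite map_polyZ map_polyXn -map_vec_mx [in RHS]mxE.
Qed.

Lemma map_pivot (A B : comNzRingType) (ev : {rmorphism A -> B}) f g :
  ev (chart_pivot f g) = chart_pivot (map_poly ev f) (map_poly ev g).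
Proof. by rewrite /chart_pivot rmorphB !rmorphM !coef_map. Qed.

Lemma map_numer (A B : comNzRingType) (ev : {rmorphism A -> B}) f g :
  map_mx ev (chart_numer f g) = chart_numer (map_poly ev f) (map_poly ev g).
Proof.
rewrite /chart_numer map_mxvec; congr mxvec; apply/matrixP => i j.
by rewrite !mxE; case: ifP => _; rewrite rmorphN rmorphB !rmorphM !coef_map.
Qed.

Section Field.
Variable F : closedFieldType.
Implicit Types (e h a b f g : {poly F}) (y : 'rV[F]_(d.-1 * (d.+1 - d.-1))).

Definition normalize f g := (chart_pivot f g)^-1 *: chart_numer f g.

Lemma pivot_form y : chart_pivot (chart_form y q0) (chart_form y q1) = 1.
Proof. by rewrite /chart_pivot !coef_form_q !eqxx q10 eq_sym q10 mulr0 subr0 mulr1. Qed.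

Lemma numer_form y : chart_numer (chart_form y q0) (chart_form y q1) = y.
Proof.
rewrite -[RHS]vec_mxK; congr mxvec; apply/matrixP => i j; rewrite mxE.
have [->|->] := q01 j; [rewrite eqxx | rewrite q10];
  by rewrite !coef_form_q !coef_form_p !eqxx ?[q0 == q1]eq_sym q10 /=; ring.
Qed.

Lemma normalize_form y : normalize (chart_form y q0) (chart_form y q1) = y.
Proof. by rewrite /normalize pivot_form numer_form invr1 scale1r. Qed.

Lemma vec_mxZ y c i j : vec_mx (c *: y) i j = c * vec_mx y i j.
Proof. by rewrite linearZ /= mxE. Qed.

Lemma form_normalize0 f g : (size f <= d.+1)%N -> (size g <= d.+1)%N -> chart_pivot f g != 0 ->
  chart_form (normalize f g) q0 = (chart_pivot f g)^-1 *: (g`_(q q1) *: f - f`_(q q1) *: g).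
Proof.
move=> sf sg D0; apply: chart_poly_eq; first exact: size_form.
- apply: leq_trans (size_scale_leq _ _) _; apply: leq_trans (size_polyD _ _) _.
  by rewrite geq_max size_polyN !(leq_trans (size_scale_leq _ _)).
- move=> i; rewrite coef_form_p vec_mxZ /chart_numer mxvecK mxE eqxx.
  by rewrite !(coefZ, coefB) mulrN opprK.
- rewrite coef_form_q eqxx !(coefZ, coefB); apply: (mulfI D0).
  by rewrite mulVKf // /chart_pivot /=; ring.
- rewrite coef_form_q [q0 == q1]eq_sym q10 !(coefZ, coefB) /=; ring.
Qed.

Lemma form_normalize1 f g : (size f <= d.+1)%N -> (size g <= d.+1)%N -> chart_pivot f g != 0 ->
  chart_form (normalize f g) q1 = (chart_pivot f g)^-1 *: (f`_(q q0) *: g - g`_(q q0) *: f).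
Proof.
move=> sf sg D0; apply: chart_poly_eq; first exact: size_form.
- apply: leq_trans (size_scale_leq _ _) _; apply: leq_trans (size_polyD _ _) _.
  by rewrite geq_max size_polyN !(leq_trans (size_scale_leq _ _)).
- move=> i; rewrite coef_form_p vec_mxZ /chart_numer mxvecK mxE q10.
  by rewrite !(coefZ, coefB) mulrN opprK.
- rewrite coef_form_q q10 !(coefZ, coefB) /=; ring.
- rewrite coef_form_q eqxx !(coefZ, coefB); apply: (mulfI D0).
  by rewrite mulVKf // /chart_pivot /=; ring.
Qed.

(* Sizes bound formal degrees, so that a defect of degree counts as a zero at infinity.
   If [d = l + m] then [common_factor 1 l m] is the locus [Sec F d l] in the chart. *)
Definition common_factor (e : {poly F}) (j m : nat) : set 'rV[F]_(d.-1 * (d.+1 - d.-1)) :=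
  [set y | exists h a b : {poly F}, [/\ (size h <= j.+1)%N, (size a <= m.+1)%N,
     (size b <= m.+1)%N, chart_form y q0 = e * h * a & chart_form y q1 = e * h * b]].

Lemma size_lin (a b : F) f g s : (size f <= s)%N -> (size g <= s)%N ->
  (size (a *: f - b *: g)%R <= s)%N.
Proof.
move=> sf sg; apply: leq_trans (size_polyD _ _) _.
by rewrite geq_max size_polyN !(leq_trans (size_scale_leq _ _)).
Qed.

Lemma normalize_common_factor e j m h a b :
  (size h <= j.+1)%N -> (size a <= m.+1)%N -> (size b <= m.+1)%N ->
  (size (e * h * a)%R <= d.+1)%N -> (size (e * h * b)%R <= d.+1)%N ->
  chart_pivot (e * h * a) (e * h * b) != 0 ->
  common_factor e j m (normalize (e * h * a) (e * h * b)).
Proof.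
set f := e * h * a; set g := e * h * b => sh sa sb sf sg D0.
exists h, ((chart_pivot f g)^-1 *: (g`_(q q1) *: a - f`_(q q1) *: b)),
  ((chart_pivot f g)^-1 *: (f`_(q q0) *: b - g`_(q q0) *: a)).
rewrite form_normalize0 // form_normalize1 //; split=> //.
- by apply: leq_trans (size_scale_leq _ _) _; apply: size_lin.
- by apply: leq_trans (size_scale_leq _ _) _; apply: size_lin.
- by rewrite /f /g -!mul_polyC; ring.
- by rewrite /f /g -!mul_polyC; ring.
Qed.

Definition at_param (t : F) (f : {poly {poly F}}) : {poly F} :=
  map_poly (horner_eval t) f.

Lemma curve_normalize (f g : {poly {poly F}}) t :
  curve_at (fun i => chart_numer f g ord0 i) (chart_pivot f g) t =
  normalize (at_param t f) (at_param t g).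
Proof.
rewrite /normalize /at_param -(map_pivot (horner_eval t)) -(map_numer (horner_eval t)).
by apply/rowP => i; rewrite !mxE mulrC.
Qed.

Lemma horner_pivot (f g : {poly {poly F}}) t :
  (chart_pivot f g).[t] = chart_pivot (at_param t f) (at_param t g).
Proof. exact: (map_pivot (horner_eval t)). Qed.

End Field.
End ChartForms.

(** * Binary forms with formal degrees *)

Section BinaryForms.
Variable F : closedFieldType.
Implicit Types a b e f g h u v w z : {poly F}.

Lemma size_mul_le f g i j : (size f <= i.+1)%N -> (size g <= j.+1)%N ->
  (size (f * g)%R <= (i + j).+1)%N.
Proof. by move=> fi gj; apply: leq_trans (size_polyMleq _ _) _; lia. Qed.

Lemma size_mul_inv f g i j : size f = i.+1 -> (size (f * g)%R <= (i + j).+1)%N ->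
  (size g <= j.+1)%N.
Proof.
move=> fi; have [->|g0] := eqVneq g 0; first by rewrite size_poly0.
have f0 : f != 0 by rewrite -size_poly_eq0 fi.
by rewrite size_mul // fi; move: (size g) => k; lia.
Qed.

(** The condition on sizes excludes a common zero at infinity, which [coprimep] does not see. *)
Definition coprime_forms (m : nat) a b :=
  coprimep a b /\ maxn (size a) (size b) = m.+1.

Lemma coprime_formsC m a b : coprime_forms m a b -> coprime_forms m b a.
Proof. by rewrite /coprime_forms coprimep_sym maxnC. Qed.

Lemma coprime_forms_wlog (P : {poly F} -> {poly F} -> Prop) m :
  (forall a b, P a b -> P b a) ->
  (forall a b, coprimep a b -> size a = m.+1 -> (size b <= m.+1)%N -> P a b) ->
  forall a b, coprime_forms m a b -> P a b.
Proof.
move=> PC Pa a b [cab mab]; have [sba|sab] := leqP (size b) (size a).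
  by apply: Pa => //; lia.
by apply/PC/Pa; [rewrite coprimep_sym | lia | lia].
Qed.

(** Reducing [u] modulo the member of full size bounds [u]; exact division by that member then
    bounds [v]. *)
Lemma bezout_forms m n a b e : coprime_forms m a b -> (m <= n)%N ->
  (size e <= (m + n).+1)%N ->
  exists u v, [/\ (size u <= n.+1)%N, (size v <= n.+1)%N & e = b * u - a * v].
Proof.
move=> cab mn se; move: a b cab; apply: coprime_forms_wlog => [a b|a b cab sa sb].
  move=> [u [v [su sv ->]]]; exists (- v), (- u); rewrite !size_polyN; split=> //; ring.
have [[s t] /= st] := Bezout_eq1_coprimepP _ _ cab.
have a0 : a != 0 by rewrite -size_poly_eq0 sa.
pose u := (e * t) %% a; pose v := - (e - b * u) %/ a.
have su : (size u <= n.+1)%N.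
  have : (size u < size a)%N by rewrite ltn_modpN0.
  by rewrite sa ltnS => H; rewrite leqW // (leq_trans H mn).
have dv : a %| e - b * u.
  have -> : e - b * u = a * (e * s + b * ((e * t) %/ a)).
    rewrite -[X in X - _]mulr1 -st; have := divp_eq (e * t) a; rewrite -/u => E.
    have -> : e * (s * a + t * b) = e * s * a + e * t * b by ring.
    by rewrite {1}E; ring.
  exact: dvdp_mulr.
have av : a * v = - (e - b * u) by rewrite mulrC divpK // dvdpNr.
exists u, v; split=> //.
- apply: (size_mul_inv sa); rewrite av size_polyN; apply: leq_trans (size_polyD _ _) _.
  by rewrite size_polyN geq_max se /=; apply: size_mul_le.
- by rewrite av; ring.
Qed.

Lemma coprime_syzygy m l a b u v : coprime_forms m a b -> b * u = a * v ->
  (size u <= (m + l).+1)%N -> (size v <= (m + l).+1)%N ->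
  exists w, [/\ (size w <= l.+1)%N, u = a * w & v = b * w].
Proof.
move=> cab; move: a b cab u v.
apply: coprime_forms_wlog => [a b H u v E su sv|a b cab sa sb u v E su sv].
  by have [w [sw -> ->]] := H v u (esym E) sv su; exists w.
have a0 : a != 0 by rewrite -size_poly_eq0 sa.
have /dvdpP[w uw] : a %| u by rewrite -(Gauss_dvdpr _ cab) E dvdp_mulr.
exists w; split; last 2 first.
- by rewrite uw mulrC.
- by apply: (mulfI a0); rewrite -E uw; ring.
- by apply: (size_mul_inv sa); rewrite mulrC -uw.
Qed.

Lemma common_linear_factor m a b : (size a <= m.+2)%N -> (size b <= m.+2)%N ->
  ~ coprime_forms m.+1 a b ->
  exists z a' b', [/\ (size z <= 2)%N, (size a' <= m.+1)%N, (size b' <= m.+1)%N,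
    a = z * a' & b = z * b'].
Proof.
move=> sa sb ncab; have [mab|mab] := ltnP (maxn (size a) (size b)) m.+2.
  (* Both degrees drop: the common zero is at infinity, where the linear form is 1. *)
  by exists 1, a, b; rewrite !mul1r size_poly1; split=> //; lia.
have : ~~ coprimep a b by apply/negP => cab; apply: ncab; split=> //; lia.
rewrite /coprimep => /closed_rootP[r]; rewrite root_gcd -!dvdp_XsubCl.
case/andP => /dvdpP[a' ea] /dvdpP[b' eb]; exists ('X - r%:P), a', b'.
have sz := size_XsubC r; split; rewrite ?sz //; last 2 first.
- by rewrite mulrC.
- by rewrite mulrC.
- by apply: (@size_mul_inv _ _ 1 m sz); rewrite mulrC -ea.
- by apply: (@size_mul_inv _ _ 1 m sz); rewrite mulrC -eb.
Qed.

(* The factor [1] is the linear form [s], which vanishes at infinity. *)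
Lemma factor_form l h : h != 0 -> (size h <= l.+1)%N ->
  exists (c : F) (z : nat -> {poly F}),
    [/\ c != 0, forall i, z i = 1 \/ exists r, z i = 'X - r%:P &
        h = c *: \prod_(i < l) z i].
Proof.
elim: l h => [|l IH] h h0 sh.
  have /size_poly1P[c c0 ->] : size h == 1%N by rewrite eqn_leq sh size_poly_gt0.
  by exists c, (fun=> 1); rewrite big_ord0 alg_polyC; split=> // i; left.
have [h' [z0 [h'0 sh' z0E ->]]] : exists h' z0, [/\ h' != 0, (size h' <= l.+1)%N,
    z0 = 1 \/ (exists r, z0 = 'X - r%:P) & h = h' * z0].
  have [sl|sl] := leqP (size h) l.+1.
    by exists h, 1; rewrite mulr1; split=> //; left.
  have /closed_rootP[r] : size h != 1%N by lia.
  rewrite -dvdp_XsubCl => /dvdpP[h' e]; exists h', ('X - r%:P); split=> //.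
  - by apply: contraNneq h0 => z; rewrite e z mul0r.
  - by apply: (@size_mul_inv _ _ 1 l (size_XsubC r)); rewrite mulrC -e.
  - by right; exists r.
have [c [z [c0 zE ->]]] := IH h' h'0 sh'.
exists c, (fun i => if i == l then z0 else z i); split=> // [i|].
  by case: ifP.
rewrite big_ord_recr /= eqxx scalerAl; congr (_ * _); congr (_ *: _).
by apply: eq_bigr => i _; rewrite ltn_eqF.
Qed.

Lemma size_prod_linear (z : nat -> {poly F}) l :
  (forall i, (i < l)%N -> (size (z i) <= 2)%N) ->
  (size (\prod_(i < l) z i)%R <= l.+1)%N.
Proof.
elim: l => [|l IH] zl; first by rewrite big_ord0 size_poly1.
rewrite big_ord_recr /=.
have := @size_mul_le (\prod_(i < l) z i) (z l) l 1; rewrite addn1; apply.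
  by apply: IH => i il; apply: zl; lia.
exact: zl.
Qed.

Lemma dvdp_linear z r f : size z = 2 -> root z r -> (z %| f) = root f r.
Proof.
move=> sz; rewrite -!dvdp_XsubCl => rz; apply: eqp_dvdl; rewrite eqp_sym.
by rewrite -(dvdp_size_eqp rz) size_XsubC sz.
Qed.

(* Lagrange interpolation, one root at a time. *)
Lemma forms_generated_by_cofactors (m L : nat) (z : nat -> {poly F}) (r : nat -> F) f :
  (forall i, (i < L.+1)%N -> size (z i) = 2 /\ root (z i) (r i)) ->
  (forall i j, (i < L.+1)%N -> (j < i)%N -> ~~ root (z j) (r i)) ->
  (size f <= (L + m).+1)%N ->
  exists u : nat -> {poly F}, (forall i, (size (u i) <= m.+1)%N) /\
    f = \sum_(i < L.+1) (\prod_(j < L.+1 | j != i :> nat) z j) * u i.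
Proof.
elim: L f => [|L IH] f zr nz sf.
  exists (fun=> f); split=> [i //|]; rewrite big_ord1 big_pred0 ?mul1r // => j.
  by rewrite ord1 eqxx.
have [sz rz] := zr L.+1 (ltnSn _).
pose P := \prod_(j < L.+1) z j.
have Pr : P.[r L.+1] != 0.
  by rewrite horner_prod; apply/prodf_neq0 => j _; rewrite -rootE; apply: nz.
have sP : (size P <= L.+2)%N.
  by apply: size_prod_linear => j jL; have [-> _] := zr j (ltnW jL).
(* [P] is the cofactor of index [L.+1], and [c] makes [f - c *: P] vanish at the last root; the
   quotient by [z L.+1] is left to the induction. *)
pose c := f.[r L.+1] / P.[r L.+1].
have /dvdpP[f' ef] : z L.+1 %| f - c *: P.
  by rewrite (dvdp_linear _ sz rz) rootE hornerD hornerN hornerZ divfK // subrr.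
have sf' : (size f' <= (L + m).+1)%N.
  apply: (@size_mul_inv _ _ 1 _ sz); rewrite mulrC -ef.
  apply: leq_trans (size_polyD _ _) _; rewrite size_polyN geq_max sf /=.
  apply: leq_trans (size_scale_leq _ _) _; lia.
have [i iL|i j iL ji|u [su fu]] := IH f' _ _ sf'.
- by apply: zr; lia.
- by apply: nz => //; lia.
exists (fun i => if i == L.+1 then c%:P else u i); split=> [i|].
  by case: eqP => // _; apply: leq_trans (size_polyC_leq1 _) _.
have -> : f = f' * z L.+1 + P * c%:P by rewrite -ef mulrC mul_polyC; ring.
rewrite [RHS]big_ord_recr /= eqxx; congr (_ + _ * _).
  rewrite fu mulr_suml; apply: eq_bigr => i _; rewrite ltn_eqF //.
  rewrite [in RHS]big_mkcond /= [in RHS]big_ord_recr /= -big_mkcond /=.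
  by rewrite gtn_eqF //=; ring.
rewrite [in RHS]big_mkcond /= [in RHS]big_ord_recr /= eqxx mulr1.
by apply: eq_bigr => j _; rewrite ltn_eqF.
Qed.

End BinaryForms.

(* Families of forms: the inner variable of [{poly {poly F}}] is the parameter. *)
Section Families.
Variable F : closedFieldType.
Implicit Types (a b e h u v w : {poly F}) (f g : {poly {poly F}}).

Lemma at_paramM t f g : at_param t (f * g) = at_param t f * at_param t g.
Proof. exact: rmorphM. Qed.

Definition line a u : {poly {poly F}} := map_poly polyC a + 'X%:P * map_poly polyC u.

Lemma at_param_const t a : at_param t (map_poly polyC a) = a.
Proof.
rewrite /at_param -map_poly_comp map_poly_id // => c _ /=.
by rewrite /horner_eval hornerC.
Qed.

Lemma at_param_line t a u : at_param t (line a u) = a + t *: u.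
Proof.
rewrite {1}/at_param rmorphD rmorphM /= -!/(at_param _ _) !at_param_const.
by rewrite /at_param map_polyC /= /horner_eval hornerX mul_polyC.
Qed.

Definition dparam f : {poly F} := map_poly (fun c : {poly F} => c^`().[0]) f.

Lemma coef_dparam f i : (dparam f)`_i = (f`_i)^`().[0].
Proof. by rewrite coef_map_id0 // deriv0 horner0. Qed.

Lemma dparamM f g : dparam (f * g) = dparam f * at_param 0 g + at_param 0 f * dparam g.
Proof.
apply/polyP => i; rewrite coefD coef_dparam !coefM raddf_sum horner_sum -big_split /=.
apply: eq_bigr => j _.
by rewrite derivM hornerD !hornerM !coef_dparam /at_param !coef_map.
Qed.

Lemma dparam_line a u : dparam (line a u) = u.
Proof.
apply/polyP => i; rewrite coef_dparam coefD mul_polyC coefZ !coef_map /=.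
by rewrite derivD derivC derivM derivX derivC !hornerE.
Qed.

Lemma dparam_const a : dparam (map_poly polyC a) = 0.
Proof. by apply/polyP => i; rewrite coef_dparam coef_map /= derivC horner0 coef0. Qed.

End Families.

(** * Tangent vectors of the chart as pairs of forms *)

Section ChartTangent.
Variables (F : closedFieldType) (d : nat).
Variables (p : 'I_d.-1 -> 'I_d.+1) (q : 'I_(d.+1 - d.-1) -> 'I_d.+1).
Hypothesis hd : (2 <= d)%N.
Hypothesis pq : chart_index p q.
Notation q0 := (q0 hd).
Notation q1 := (q1 hd).
Notation form := (chart_form p q).
Notation pivot := (chart_pivot q hd).
Notation normalize := (normalize p q hd).
Notation common_factor := (@common_factor d p q hd F).
Implicit Types (a b e f g h u v w : {poly F}) (y : 'rV[F]_(d.-1 * (d.+1 - d.-1))).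

(* The image of [(u, v)] under the differential of [normalize] at the forms of [y]. *)
Definition direction y u v : 'rV[F]_(d.-1 * (d.+1 - d.-1)) :=
  mxvec (\matrix_(i, j) (let w := if j == q0 then u else v in
    - (w`_(p i) + w`_(q q0) * vec_mx y i q0 + w`_(q q1) * vec_mx y i q1))).

Lemma directionD y u v u' v' :
  direction y (u + u') (v + v') = direction y u v + direction y u' v'.
Proof.
rewrite /direction -raddfD; congr mxvec; apply/matrixP => i j; rewrite !mxE.
by case: ifP => _; rewrite !coefD; ring.
Qed.

Lemma direction0 y : direction y 0 0 = 0.
Proof.
rewrite /direction -[RHS](raddf0 mxvec); congr mxvec; apply/matrixP => i j.
by rewrite !mxE if_same !coef0; ring.
Qed.

Lemma direction_sum y (n : nat) (u v : nat -> {poly F}) :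
  direction y (\sum_(i < n) u i) (\sum_(i < n) v i) = \sum_(i < n) direction y (u i) (v i).
Proof.
elim: n => [|n IH]; first by rewrite !big_ord0 direction0.
by rewrite !big_ord_recr /= directionD IH.
Qed.

(** The derivative of [chart_form] in the direction [v]; it does not depend on the point, as
    [chart_form] is affine in the coordinates. *)
Definition tangent_form (v : 'rV[F]_(d.-1 * (d.+1 - d.-1))) j : {poly F} := - \sum_i vec_mx v i j *: 'X^(p i).

Lemma coef_tangent_form_q (v : 'rV[F]_(d.-1 * (d.+1 - d.-1))) j j' : (tangent_form v j)`_(q j') = 0.
Proof.
rewrite coefN coef_sum big1 ?oppr0 // => i _.
by rewrite coefZ coefXn eq_sym (inj_eq val_inj) (negPf (chart_pq_neq pq _ _)) mulr0.
Qed.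

Lemma coef_tangent_form_p (v : 'rV[F]_(d.-1 * (d.+1 - d.-1))) j i : (tangent_form v j)`_(p i) = - vec_mx v i j.
Proof.
rewrite coefN coef_sum (bigD1 i) //= coefZ coefXn eqxx mulr1 big1 ?addr0 // => i' ii'.
by rewrite coefZ coefXn (inj_eq val_inj) (inj_eq (chart_p_inj pq)) eq_sym (negPf ii') mulr0.
Qed.

Lemma tangent_form_linear c (u v : 'rV[F]_(d.-1 * (d.+1 - d.-1))) j :
  tangent_form (c *: u + v) j = c *: tangent_form u j + tangent_form v j.
Proof.
rewrite /tangent_form scalerN scaler_sumr -opprD -big_split; congr (- _).
by apply: eq_bigr => i _; rewrite linearD linearZ /= !mxE scalerDl scalerA.
Qed.

Lemma size_tangent_form (v : 'rV[F]_(d.-1 * (d.+1 - d.-1))) j : (size (tangent_form v j) <= d.+1)%N.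
Proof.
rewrite size_polyN; apply: leq_trans (size_sum _ _ _) _; apply/bigmax_leqP => i _.
by apply: leq_trans (size_scale_leq _ _) _; rewrite size_polyXn.
Qed.

Lemma direction_tangent_form y (v : 'rV[F]_(d.-1 * (d.+1 - d.-1))) : direction y (tangent_form v q0) (tangent_form v q1) = v.
Proof.
rewrite -[RHS]vec_mxK; congr mxvec; apply/matrixP => i j; rewrite mxE /=.
have [->|->] := q01 hd j; [rewrite eqxx | rewrite q10];
  by rewrite !coef_tangent_form_q coef_tangent_form_p; ring.
Qed.

(* Modulo the forms of [y], every pair of forms comes from a tangent vector of the chart. *)
Lemma tangent_form_direction y u v (j : bool) : (size u <= d.+1)%N -> (size v <= d.+1)%N ->
  let w := if j then u else v in
  w = tangent_form (direction y u v) (if j then q0 else q1) +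
        (w`_(q q0) *: form y q0 + w`_(q q1) *: form y q1).
Proof.
move=> su sv w; have sw : (size w <= d.+1)%N by rewrite /w; case: (j).
have s1 : (size (w`_(q q0) *: form y q0 + w`_(q q1) *: form y q1)%R <= d.+1)%N.
  apply: leq_trans (size_polyD _ _) _.
  by rewrite geq_max !(leq_trans (size_scale_leq _ _)) ?size_form.
apply: (@chart_poly_eq _ _ _ hd pq F) => //.
- by apply: leq_trans (size_polyD _ _) _; rewrite geq_max size_tangent_form s1.
- move=> i; rewrite coefD [X in _ + X]coefD !coefZ coef_tangent_form_p !(coef_form_p pq) /direction mxvecK mxE.
  by rewrite /w; case: (j); rewrite ?eqxx ?q10 /=; ring.
- by rewrite coefD [X in _ + X]coefD !coefZ coef_tangent_form_q !(coef_form_q pq) eqxx q10 /=; ring.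
- by rewrite coefD [X in _ + X]coefD !coefZ coef_tangent_form_q !(coef_form_q pq) eqxx [q0 == _]eq_sym q10 /=; ring.
Qed.

(** The pivot is 1 at parameter 0 because the forms of [y] are reduced, so [curve_tangent] applies;
    the quotient rule turns its velocity into [direction]. *)
Lemma normalize_tangent X y (f g : {poly {poly F}}) :
  at_param 0 f = form y q0 -> at_param 0 g = form y q1 ->
  (forall t, pivot (at_param t f) (at_param t g) != 0 ->
     X (normalize (at_param t f) (at_param t g))) ->
  in_tangent X y (direction y (dparam f) (dparam g)).
Proof.
move=> f0 g0 H; pose N i := chart_numer p q hd f g ord0 i; pose D := chart_pivot q hd f g.
have c0 (k : {poly {poly F}}) i : (k`_i).[0] = (at_param 0 k)`_i.
  by rewrite /at_param coef_map.
have D0 : D.[0] = 1 by rewrite /D horner_pivot f0 g0 pivot_form.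
have -> : direction y (dparam f) (dparam g) =
    \row_i ((N i)^`().[0] - D^`().[0] * y ord0 i).
  apply/rowP => k; rewrite mxE; case/mxvec_indexP: k => i j.
  rewrite /N /chart_numer /direction !mxvecE !mxE.
  have -> : y ord0 (mxvec_index i j) = vec_mx y i j by rewrite mxE.
  rewrite /D /chart_pivot; have [->|->] := q01 hd j; rewrite ?eqxx ?q10;
    rewrite !(derivN, derivB, derivM, hornerN, hornerD, hornerM) !c0 f0 g0 -!coef_dparam;
    by rewrite !(coef_form_q pq) !(coef_form_p pq) !eqxx q10 ?[q0 == _]eq_sym ?q10 /= ![vec_mx _ _ _]mxE; ring.
apply: (curve_tangent (D := D) (N := N)) => // [i|t Dt].
  by rewrite -[RHS](congr1 (fun M : 'rV_ _ => M ord0 i) (numer_form hd pq y)) -f0 -g0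
    -(map_numer _ _ _ (horner_eval 0)) mxE.
by rewrite curve_normalize; apply: H; rewrite -horner_pivot.
Qed.

End ChartTangent.

Lemma exists_distinct (F : closedFieldType) n :
  exists c : nat -> F, forall i j, (i < n)%N -> (j < n)%N -> c i = c j -> i = j.
Proof.
suff [s us sn] : exists2 s : seq F, uniq s & size s = n.
  exists (nth 0 s) => i j il jl /eqP; rewrite nth_uniq ?sn // => /eqP //.
elim: n => [|n [s us sn]]; first by exists [::].
have : \prod_(x <- s) ('X - x%:P) != 0 by rewrite monic_neq0 // monic_prod_XsubC.
case/closed_nonrootP => x; rewrite root_prod_XsubC => xs.
by exists (x :: s); rewrite /= ?xs ?sn.
Qed.

(** * Points with a larger common divisor: the tangent space is everything *)

Section SingularTangent.
Variables (F : closedFieldType) (d : nat).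
Variables (p : 'I_d.-1 -> 'I_d.+1) (q : 'I_(d.+1 - d.-1) -> 'I_d.+1).
Hypothesis hd : (2 <= d)%N.
Hypothesis pq : chart_index p q.
Notation q0 := (q0 hd).
Notation q1 := (q1 hd).
Notation form := (chart_form p q).
Notation pivot := (chart_pivot q hd).
Notation normalize := (normalize p q hd).
Notation common_factor := (@common_factor d p q hd F).
Implicit Types (a b e f g h u w : {poly F}) (y v : 'rV[F]_(d.-1 * (d.+1 - d.-1))).

Lemma chart_form_neq0 y j : form y j != 0.
Proof.
apply/eqP => /(congr1 (fun f : {poly F} => f`_(q j))).
by rewrite (coef_form_q pq) eqxx coef0 => /eqP; rewrite oner_eq0.
Qed.

(** Each summand of the interpolation is the velocity of the pencil [P i * (z i * a + t *: u i)],
    [P i * (z i * b + t *: w i)]: after [z i] is given up, the divisor [P i] of formal degree [l] is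
    still common. *)
Lemma full_tangent_distinct l m y a b (z : nat -> {poly F}) (r : nat -> F) v :
  d = (l + m.+1)%N -> (size a <= m.+1)%N -> (size b <= m.+1)%N ->
  (forall i, (i < l.+1)%N -> size (z i) = 2 /\ root (z i) (r i)) ->
  (forall i j, (i < l.+1)%N -> (j < i)%N -> ~~ root (z j) (r i)) ->
  form y q0 = (\prod_(i < l.+1) z i) * a ->
  form y q1 = (\prod_(i < l.+1) z i) * b ->
  in_tangent (common_factor 1 l m.+1) y v.
Proof.
move=> dlm sa sb zr nz ya yb.
have sv j : (size (tangent_form p v j) <= (l + m.+1).+1)%N by rewrite -dlm size_tangent_form.
have [u [su ue]] := forms_generated_by_cofactors zr nz (sv q0).
have [w [sw we]] := forms_generated_by_cofactors zr nz (sv q1).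
pose P (i : nat) := \prod_(j < l.+1 | j != i :> nat) z j.
rewrite -(direction_tangent_form hd pq y v) ue we.
rewrite (direction_sum _ _ _ _ _ (fun i => P i * u i) (fun i => P i * w i)).
apply/mem_tangent_space; apply: memv_suml => i _; apply/mem_tangent_space.
have Pz : P i * z i = \prod_(i < l.+1) z i by rewrite [RHS](bigD1 i) //= mulrC.
have [szi _] := zr i (ltn_ord i).
have sP : (size (P i) <= l.+1)%N.
  apply: (@size_mul_inv _ (z i) _ 1 _ szi); rewrite mulrC Pz.
  by apply: size_prod_linear => j jl; have [-> _] := zr j jl.
have sza (c : {poly F}) t (u' : nat -> {poly F}) : (forall i, (size (u' i) <= m.+2)%N) -> (size c <= m.+1)%N ->
    (size (z i * c + t *: u' i)%R <= m.+2)%N.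
  move=> su' sc; apply: leq_trans (size_polyD _ _) _; rewrite geq_max.
  have := @size_mul_le _ (z i) c 1 m; rewrite szi => -> //=.
  exact: leq_trans (size_scale_leq _ _) _.
have sPz (c : {poly F}) t (u' : nat -> {poly F}) : (forall i, (size (u' i) <= m.+2)%N) -> (size c <= m.+1)%N ->
    (size (P i * (z i * c + t *: u' i))%R <= d.+1)%N.
  by move=> su' sc; rewrite dlm; apply: size_mul_le => //; apply: sza.
have := @normalize_tangent F d p q hd pq (common_factor 1 l m.+1) y
  (map_poly polyC (P i) * line (z i * a) (u i)) (map_poly polyC (P i) * line (z i * b) (w i)).
rewrite !dparamM !dparam_const !dparam_line !mul0r !add0r !at_param_const; apply.
- by rewrite at_paramM at_param_const at_param_line scale0r addr0 mulrA Pz.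
- by rewrite at_paramM at_param_const at_param_line scale0r addr0 mulrA Pz.
move=> t; rewrite !at_paramM !at_param_const !at_param_line => D0.
have := @normalize_common_factor d p q hd pq F 1 l m.+1 (P i)
  (z i * a + t *: u i) (z i * b + t *: w i).
by rewrite !mul1r; apply=> //; [apply: sza | apply: sza | apply: sPz | apply: sPz].
Qed.

(* Moving the linear factors of the common divisor makes them distinct and finite. *)
Lemma full_tangent l m y v : d = (l + m.+1)%N ->
  common_factor 1 l.+1 m y -> in_tangent (common_factor 1 l m.+1) y v.
Proof.
move=> dlm [h [a' [b' [sh sa' sb']]]]; rewrite mul1r => ya yb f fX.
have h0 : h != 0.
  by apply: contraNneq (chart_form_neq0 y q0) => h0; rewrite ya h0 mul0r.
have [c [z [c0 zE hE]]] := factor_form h0 sh.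
pose a := c *: a'; pose b := c *: b'.
have sa : (size a <= m.+1)%N by apply: leq_trans (size_scale_leq _ _) _.
have sb : (size b <= m.+1)%N by apply: leq_trans (size_scale_leq _ _) _.
have {ya} ya : form y q0 = (\prod_(i < l.+1) z i) * a.
  by rewrite ya hE -scalerAl scalerAr.
have {yb} yb : form y q1 = (\prod_(i < l.+1) z i) * b.
  by rewrite yb hE -scalerAl scalerAr.
have [x xinj] := exists_distinct F l.+1.
pose zl i := line (z i) ('X + (x i)%:P); pose zt t i := z i + t *: ('X + (x i)%:P).
pose H := \prod_(i < l.+1) zl i.
pose fl := H * map_poly polyC a; pose gl := H * map_poly polyC b.
have atH t : at_param t H = \prod_(i < l.+1) zt t i.
  rewrite /at_param /H rmorph_prod; apply: eq_bigr => i _.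
  exact: at_param_line.
have at0 : at_param 0 H = \prod_(i < l.+1) z i.
  by rewrite atH; apply: eq_bigr => i _; rewrite /zt scale0r addr0.
have zsize i : (size (z i) <= 2)%N.
  by case: (zE i) => [->|[r ->]]; rewrite ?size_poly1 ?size_XsubC.
have ztE t i : zt t i = ((z i)`_1 + t) *: 'X + ((z i)`_0 + t * x i)%:P.
  apply/polyP => -[|[|k]]; rewrite /zt !(coefD, coefZ, coefX, coefC) /=; try by ring.
  by rewrite nth_default ?(leq_trans (zsize i)) //; ring.
pose lead i : {poly F} := 'X + ((z i)`_1)%:P.
(* The resultant of [zt t i] and [zt t j] as a polynomial in [t]. Its coefficient of degree 2 is
   [x j - x i], hence nonzero; [lead i] is the leading coefficient of [zt t i], whose root is finite
   when it is nonzero. *)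
pose res i j : {poly F} := ('X * (x j)%:P + ((z j)`_0)%:P) * lead i -
  lead j * ('X * (x i)%:P + ((z i)`_0)%:P).
pose E := \prod_(i < l.+1) (lead i * \prod_(j < l.+1 | (j < i)%N) res i j).
have lead0 i : lead i != 0 by rewrite -lead_coef_eq0 lead_coefXaddC oner_eq0.
have E0 : E != 0.
  apply/prodf_neq0 => i _; rewrite mulf_neq0 //; apply/prodf_neq0 => j ji.
  apply/eqP => /(congr1 (fun f : {poly F} => f`_2)); rewrite coef0.
  have -> : res i j = 'X^2 * (x j - x i)%:P + 'X * (x j * (z i)`_1 + (z j)`_0 -
      (z i)`_0 - x i * (z j)`_1)%:P + ((z j)`_0 * (z i)`_1 - (z j)`_1 * (z i)`_0)%:P.
    rewrite /res /lead !(rmorphD, rmorphB, rmorphM) /=; ring.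
  rewrite !(coefD, coefMC, coefXn, coefX, coefC) /= !mul0r !addr0 mul1r => /eqP.
  rewrite subr_eq0 => /eqP /xinj e; move: ji; rewrite e ?ltnn //; exact: ltn_ord.
(* The derivative of [f] along the fixed vector [v]: it vanishes on the curve off the roots of [E]
   by the case of distinct roots, and so at [y]. *)
pose G := \sum_i v ord0 i *: f^`M(i).
have GE y' : G.@[y' ord0] = \sum_i v ord0 i * (f^`M(i)).@[y' ord0].
  by rewrite raddf_sum; apply: eq_bigr => i _; apply: mevalZ.
have a0 : at_param 0 fl = form y q0 by rewrite at_paramM at0 at_param_const.
have b0 : at_param 0 gl = form y q1 by rewrite at_paramM at0 at_param_const.
have := @curve_closed F _ G (fun i => chart_numer p q hd fl gl ord0 i) (pivot fl gl) E _ E0.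
rewrite curve_normalize a0 b0 (normalize_form hd pq) GE; apply.
  by rewrite horner_pivot a0 b0 (pivot_form hd pq) oner_neq0.
move=> t Et; rewrite curve_normalize horner_pivot GE => Dt.
suff /(_ f fX) : in_tangent (common_factor 1 l m.+1)
  (normalize (at_param t fl) (at_param t gl)) v by [].
have /prodf_neq0 Ei : \prod_(i < l.+1) (lead i * \prod_(j < l.+1 | (j < i)%N) res i j).[t] != 0.
  by rewrite -horner_prod.
have leadt i : (i < l.+1)%N -> (z i)`_1 + t != 0.
  move=> il; have := Ei (Ordinal il) isT.
  by rewrite hornerM mulf_eq0 negb_or hornerD hornerX hornerC addrC => /andP[].
have rest i j : (i < l.+1)%N -> (j < i)%N -> (res i j).[t] != 0.
  move=> il ji; have := Ei (Ordinal il) isT.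
  rewrite hornerM mulf_eq0 negb_or horner_prod => /andP[_ /prodf_neq0].
  by move/(_ (Ordinal (ltn_trans ji il)) ji).
have sprod : (size (\prod_(i < l.+1) zt t i)%R <= l.+2)%N.
  apply: size_prod_linear => i _; apply: leq_trans (size_polyD _ _) _.
  by rewrite geq_max zsize /= (leq_trans (size_scale_leq _ _)) // size_XaddC.
have sfa (k : {poly F}) : (size k <= m.+1)%N -> (size (\prod_(i < l.+1) zt t i * k)%R <= d.+1)%N.
  by move=> sk; rewrite dlm addnS -addSn; apply: size_mul_le.
have fE : at_param t fl = \prod_(i < l.+1) zt t i * a by rewrite at_paramM atH at_param_const.
have gE : at_param t gl = \prod_(i < l.+1) zt t i * b by rewrite at_paramM atH at_param_const.
have := Dt; rewrite fE gE => Dt'.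
apply: (@full_tangent_distinct l m _
   ((pivot (at_param t fl) (at_param t gl))^-1 *:
      ((at_param t gl)`_(q q1) *: a - (at_param t fl)`_(q q1) *: b))
   ((pivot (at_param t fl) (at_param t gl))^-1 *:
      ((at_param t fl)`_(q q0) *: b - (at_param t gl)`_(q q0) *: a))
   (zt t) (fun i => - ((z i)`_0 + t * x i) / ((z i)`_1 + t))) => //.
- by apply: leq_trans (size_scale_leq _ _) _; apply: size_lin.
- by apply: leq_trans (size_scale_leq _ _) _; apply: size_lin.
- move=> i il; have := leadt i il; rewrite ztE => ti; split.
    by rewrite -mul_polyC size_MXaddC polyC_eq0 (negPf ti) /= size_polyC ti.
  by rewrite rootE hornerD hornerZ hornerX hornerC mulrC divfK // addNr.
- move=> i j il ji; rewrite rootE ztE hornerD hornerZ hornerX hornerC.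
  have := rest i j il ji; apply: contraNneq => e.
  have ti := leadt i il.
  have := congr1 (fun s => s * ((z i)`_1 + t)) e; rewrite mul0r => {}e.
  apply/eqP; rewrite /res /lead !(hornerD, hornerN, hornerM, hornerX, hornerC) -[RHS]e.
  by field.
- rewrite fE gE (form_normalize0 pq) ?sfa //.
  by move: (\prod_(i < l.+1) zt t i) => Pt; rewrite -!mul_polyC; ring.
- rewrite fE gE (form_normalize1 pq) ?sfa //.
  by move: (\prod_(i < l.+1) zt t i) => Pt; rewrite -!mul_polyC; ring.
Qed.

End SingularTangent.

Section RowSpaces.
Variables (F : fieldType) (N n : nat).

Lemma dim_vspace_rowspace (M : 'M[F]_(n, N)) (T : {vspace 'rV[F]_N}) :
  (forall v, v \in T <-> (v <= M)%MS) -> \dim T = \rank M.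
Proof.
move=> TM; pose f : 'Hom('rV[F]_(\rank M), 'rV[F]_N) := linfun (mulmxr (row_base M)).
have -> : T = (f @: fullv)%VS.
  apply/vspaceP => v; apply/idP/memv_imgP.
    move/TM; rewrite -(eq_row_base M) => /submxP[u ->]; exists u; rewrite ?memvf //.
    by rewrite lfunE.
  move=> [u _ ->]; apply/TM; rewrite lfunE /= -(eq_row_base M); exact: submxMl.
rewrite limg_dim_eq ?dimvf /dim /= ?mul1n //; apply/eqP; rewrite capfv.
apply/lker0P => u v; rewrite !lfunE /= => e.
exact: (row_free_inj (row_base_free M)).
Qed.

Lemma linear_mx (L : 'rV[F]_N -> 'rV[F]_n) : linear L -> exists M, forall v, L v = v *m M.
Proof.
move=> linL; pose L' : {linear 'rV[F]_N -> 'rV[F]_n} :=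
  HB.pack L (GRing.isLinear.Build F 'rV[F]_N 'rV[F]_n _ L linL).
by exists (lin1_mx L') => v; rewrite mul_rV_lin1.
Qed.

End RowSpaces.

Lemma size_rVpoly (R : nzRingType) n (u : 'rV[R]_n) : (size (rVpoly u) <= n)%N.
Proof. exact: size_poly. Qed.

(** * Points whose common divisor has degree exactly l: the tangent space *)

Section Sylvester.
Variables (m n : nat).

Section Generic.
Variable A : comNzRingType.
Implicit Types a b f g : {poly A}.

Definition mulmat f : 'M[A]_(m.+1, n) := \matrix_(i, t) ('X^i * f)`_t.

Definition sylvester f g : 'M[A]_(m.+1 + m.+1, n) := col_mx (mulmat f) (mulmat g).

Lemma mul_mulmat (u : 'rV[A]_m.+1) f : u *m mulmat f = poly_rV (rVpoly u * f).
Proof.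
apply/rowP => t; rewrite !mxE {2}[u]row_sum_delta raddf_sum mulr_suml coef_sum.
apply: eq_bigr => i _.
by rewrite mxE /= linearZ /= rVpoly_delta -scalerAl coefZ.
Qed.

Lemma mul_sylvester (u : 'rV[A]_(m.+1 + m.+1)) f g :
  u *m sylvester f g = poly_rV (rVpoly (lsubmx u) * f + rVpoly (rsubmx u) * g).
Proof. by rewrite -[u in LHS]hsubmxK mul_row_col !mul_mulmat raddfD. Qed.

Lemma row_mul_sylvester a b f g : (size a <= m.+1)%N -> (size b <= m.+1)%N ->
  row_mx (poly_rV a) (poly_rV b) *m sylvester f g = poly_rV (a * f + b * g).
Proof. by move=> sa sb; rewrite mul_sylvester row_mxKl row_mxKr !poly_rV_K. Qed.

End Generic.

Lemma map_sylvester (A B : comNzRingType) (ev : {rmorphism A -> B}) f g :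
  map_mx ev (sylvester f g) = sylvester (map_poly ev f) (map_poly ev g).
Proof.
rewrite map_col_mx; congr col_mx; apply/matrixP => i t; rewrite !mxE;
  by rewrite -coef_map rmorphM /= map_polyXn.
Qed.

Lemma sylvesterDZ (A : comNzRingType) (f g u v : {poly A}) t :
  sylvester (f + t *: u) (g + t *: v) = sylvester f g + t *: sylvester u v.
Proof.
rewrite scale_col_mx add_col_mx; congr col_mx; apply/matrixP => i k;
  by rewrite !mxE mulrDr coefD -scalerAr coefZ.
Qed.

End Sylvester.

Section SmoothTangent.
Variables (F : closedFieldType) (d : nat).
Variables (p : 'I_d.-1 -> 'I_d.+1) (q : 'I_(d.+1 - d.-1) -> 'I_d.+1).
Hypothesis hd : (2 <= d)%N.
Hypothesis pq : chart_index p q.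
Notation q0 := (q0 hd).
Notation q1 := (q1 hd).
Notation form := (chart_form p q).
Notation normalize := (normalize p q hd).
Notation common_factor := (@common_factor d p q hd F).
Notation N := (d.-1 * (d.+1 - d.-1))%N.
Implicit Types (a b e f g h u w : {poly F}) (y v : 'rV[F]_N).

Variables (l m : nat).
Hypothesis dlm : d = (l + m)%N.

(** Over a general ring, since it is also evaluated at the generic point, whose coordinates are the
    variables of [{mpoly F[N]}]. *)
Let sylv (A : comNzRingType) (y : 'rV[A]_N) : 'M[A]_(m.+1 + m.+1, (d + m).+1) :=
  sylvester m (d + m).+1 (form y q0) (form y q1).
Let tsylv (v : 'rV[F]_N) := sylvester m (d + m).+1 (tangent_form p v q0) (tangent_form p v q1).

Lemma chart_form_line y v t j :
  form (y + t *: v) j = form y j + t *: tangent_form p v j.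
Proof.
rewrite /chart_form /tangent_form scalerN scaler_sumr -addrA -opprD -big_split; congr (_ - _).
by apply: eq_bigr => i _; rewrite linearD linearZ /= !mxE scalerDl scalerA.
Qed.

(** The nonzero row [(b, - a)] is a relation among the 2 m + 2 rows. *)
Lemma rank_sylv_common_factor y : common_factor 1 l m y -> (\rank (sylv y) <= m + m.+1)%N.
Proof.
move=> [h [a [b [sh sa sb]]]]; rewrite mul1r => ya yb.
have /negP k0 : row_mx (poly_rV b) (poly_rV (- a)) != 0 :> 'rV[F]_(m.+1 + m.+1).
  apply/eqP => /(congr1 rsubmx); rewrite row_mxKr raddf0 => /(congr1 rVpoly).
  rewrite poly_rV_K ?size_polyN // raddf0 => /eqP; rewrite oppr_eq0 => /eqP a0.
  by move: (chart_form_neq0 pq y q0); rewrite ya a0 mulr0 eqxx.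
rewrite leqNgt; apply/negP => rk; apply: k0; rewrite -[_ == 0]submx0.
have : row_free (sylv y) by rewrite -row_leq_rank.
rewrite -kermx_eq0 => /eqP <-; apply/sub_kermxP.
rewrite row_mul_sylvester ?size_polyN // ya yb.
by rewrite (_ : _ + _ = 0) ?raddf0 //; ring.
Qed.

Variables (y0 : 'rV[F]_N) (h a b : {poly F}).
Hypothesis sh : (size h <= l.+1)%N.
Hypothesis cab : coprime_forms m a b.
Hypothesis ya : form y0 q0 = h * a.
Hypothesis yb : form y0 q1 = h * b.

Let sa : (size a <= m.+1)%N. Proof. by case: cab => _; lia. Qed.
Let sb : (size b <= m.+1)%N. Proof. by case: cab => _; lia. Qed.
Let X := common_factor 1 l m.
Let k : 'rV[F]_(m.+1 + m.+1) := row_mx (poly_rV b) (poly_rV (- a)).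
Let B := sylv y0.

Let h0 : h != 0.
Proof.
by apply: contraNneq (chart_form_neq0 pq y0 q0) => h0; rewrite ya h0 mul0r.
Qed.

Let y0X : X y0.
Proof. by exists h, a, b; rewrite mul1r. Qed.

Let kB : k *m B = 0.
Proof.
rewrite row_mul_sylvester ?size_polyN // ya yb.
by rewrite (_ : _ + _ = 0) ?raddf0 //; ring.
Qed.

Lemma rank_sylv_coprime : \rank B = (m + m.+1)%N.
Proof.
apply/eqP; rewrite eqn_leq rank_sylv_common_factor //=.
have : (kermx B <= k)%MS.
  apply/row_subP => i; set u := row i _.
  have uB : u *m B = 0 by rewrite -row_mul mulmx_ker row0.
  move: uB; rewrite mul_sylvester ya yb => /(congr1 rVpoly).
  set u1 := rVpoly (lsubmx u); set u2 := rVpoly (rsubmx u).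
  (* Writing the bound as [m + 0] makes the multiplier [w] of the syzygy a constant, so that the
     left kernel is the line of [k]. *)
  have su1 : (size u1 <= (m + 0).+1)%N by rewrite addn0; apply: size_rVpoly.
  have su2 : (size (- u2)%R <= (m + 0).+1)%N by rewrite addn0 size_polyN; apply: size_rVpoly.
  have sm (c e1 : {poly F}) : (size c <= (m + 0).+1)%N -> (size e1 <= m.+1)%N ->
      (size (c * (h * e1))%R <= (d + m).+1)%N.
    rewrite addn0 dlm addnC => sc se; apply: size_mul_le => //.
    exact: size_mul_le.
  rewrite raddf0 poly_rV_K => [E|]; last first.
    apply: leq_trans (size_polyD _ _) _.
    by rewrite geq_max !sm // -size_polyN.
  have E' : a * u1 = b * (- u2).
    by apply: (mulfI h0); apply/eqP; rewrite -subr_eq0 -[X in _ == X]E; apply/eqP; ring.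
  have [w [sw w1 w2]] := coprime_syzygy (coprime_formsC cab) E' su1 su2.
  have uE : u = row_mx (poly_rV u1) (poly_rV u2).
    by rewrite !rVpolyK hsubmxK.
  rewrite uE; apply/submxP; exists (w`_0)%:M; rewrite mul_scalar_mx scale_row_mx -!linearZ /=.
  have wc : w = (w`_0)%:P := size1_polyC sw.
  congr row_mx; congr poly_rV; first by rewrite w1 {1}wc mulrC mul_polyC.
  by rewrite -[u2]opprK w2 {1}wc mulrC mul_polyC.
move/mxrankS; rewrite mxrank_ker => /leq_trans/(_ (rank_leq_row _)); lia.
Qed.

(* For [lam] in the kernel of the Sylvester matrix [B] at [y0], choose constant matrices [C],
   with first row [k], and [P], with first column [lam], such that the determinant of
   [C *m sylv y *m P] vanishes on [X] by [rank_sylv_common_factor] and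
   [C *m B *m P] is the identity up to a zero first row and column. The derivative of this
   determinant at [y0] in the direction [v] is then [k *m tsylv v *m lam]. *)
Lemma tangent_sylvester v : in_tangent X y0 v -> (k *m tsylv v <= B)%MS.
Proof.
move=> vT; rewrite submxE; apply/eqP/matrixP => i0 j; rewrite ord1 [RHS]mxE.
pose lam := col j (cokermx B).
have Blam : B *m lam = 0 by rewrite /lam colE mulmxA mulmx_coker mul0mx.
have [C1 C1B] : exists C1, row_base B = C1 *m B.
  by apply/submxP; rewrite eq_row_base.
have [P1 P1B] : exists P1, row_base B *m P1 = 1%:M.
  by apply/row_freeP; apply: row_base_free.
pose C : 'M[F]_(1 + \rank B, m.+1 + m.+1) := col_mx k C1.
pose P : 'M[F]_((d + m).+1, 1 + \rank B) := row_mx lam P1.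
pose Y : 'rV[{mpoly F[N]}]_N := \row_i 'X_i.
pose D := \det (map_mx (@mpolyC N F) C *m sylv Y *m map_mx (@mpolyC N F) P).
have DE (y : 'rV[F]_N) : D.@[y ord0] = \det (C *m sylv y *m P).
  rewrite /D -(det_map_mx (meval (y ord0))) !map_mxM /= -!map_mx_comp.
  have mapC r c (M : 'M[F]_(r, c)) : map_mx (meval (y ord0) \o @mpolyC N F) M = M.
    by apply/matrixP => ? ?; rewrite mxE /= mevalC.
  rewrite !mapC map_sylvester !map_form.
  have -> // : map_mx (meval (y ord0)) Y = y.
  by apply/rowP => i; rewrite !mxE mevalXU.
(* An invertible product has rank [1 + \rank B], while [sylv y] has rank at most [\rank B] for [y]
   in [X]. *)
have DX : vanishing_ideal X D.
  move=> y yX; rewrite DE; apply/eqP; rewrite -[_ == 0]negbK -unitfE -unitmxE.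
  apply/negP => /mxrank_unit rk; have := rank_sylv_common_factor yX.
  rewrite -rank_sylv_coprime leqNgt => /negP; apply.
  by rewrite -[X in (X <= _)%N]rk (leq_trans (mxrankM_maxl _ _)) // mxrankM_maxr.
have [kk [g [Hg dg]]] := homogenize_curve (fun i => (y0 ord0 i)%:P + v ord0 i *: 'X) D (hornerC 1 0).
pose W := \det (map_mx polyC C *m (map_mx polyC B + 'X *: map_mx polyC (tsylv v)) *m map_mx polyC P).
have gW : g = W.
  apply/eqP; rewrite -subr_eq0; apply/eqP/horner_eq0 => t.
  rewrite hornerD hornerN Hg ?hornerC ?oner_neq0 // expr1n mul1r.
  rewrite (@meval_eq _ _ _ ((y0 + t *: v) ord0)); last first.
    by move=> i; rewrite divr1 !mxE !hornerE [v _ _ * t]mulrC.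
  rewrite DE -[W.[t]]/(horner_eval t W) -det_map_mx !map_mxM /= map_mxD map_mxZ -!map_mx_comp /=.
  have mapC r c (M : 'M[F]_(r, c)) : map_mx (horner_eval t \o polyC) M = M.
    by apply/matrixP => ? ?; rewrite mxE /= /horner_eval hornerC.
  rewrite !mapC /horner_eval hornerX; apply/eqP; rewrite subr_eq0; apply/eqP.
  congr (\det (_ *m _ *m _)).
  by rewrite /sylv !chart_form_line sylvesterDZ.
have W0 : W^`().[0] = 0.
  rewrite -gW dg derivC horner0 mul0rn mul0r add0r.
  have := vT D DX; move=> e; rewrite -[RHS]e; apply: eq_bigr => i _.
  rewrite derivD derivC derivZ derivX !hornerE subr0; congr (_ * _).
  by apply: meval_eq => i'; rewrite !hornerE.
pose rho := map_mx polyC (k *m tsylv v *m P).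
pose R := map_mx polyC C1 *m (map_mx polyC B + 'X *: map_mx polyC (tsylv v)) *m map_mx polyC P.
(* Since [k *m B = 0], the first row is divisible by the parameter, so that the derivative at 0 is
   the value at 0 of the other factor. *)
have WE : W = 'X * \det (col_mx rho R).
  have -> : 'X * \det (col_mx rho R) = \det (block_mx 'X%:M 0 0 1%:M *m col_mx rho R).
    by rewrite det_mulmx det_ublock det1 mulr1 det_scalar1.
  rewrite /W map_col_mx !mul_col_mx; congr (\det _).
  rewrite !mul_row_col !mul0mx addr0 add0r mul1mx mul_scalar_mx; congr col_mx.
  have kBp : map_mx polyC k *m map_mx polyC B = 0 by rewrite -map_mxM kB map_mx0.
  by rewrite mulmxDr kBp add0r -scalemxAr -scalemxAl /rho !map_mxM.
move: W0; rewrite WE derivM derivX mul1r hornerD hornerM hornerX mul0r addr0.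
rewrite -[X in X = _ -> _]/(horner_eval 0 _) -det_map_mx map_col_mx /rho /R.
rewrite !map_mxM /= map_mxD map_mxZ -!map_mx_comp /=.
have mapC r c (M : 'M[F]_(r, c)) : map_mx (horner_eval 0 \o polyC) M = M.
  by apply/matrixP => ? ?; rewrite mxE /= /horner_eval hornerC.
rewrite !mapC /horner_eval hornerX scale0r addr0 /P !mul_mx_row.
(* At 0 the lower blocks are [C1 *m B *m lam = 0] and [C1 *m B *m P1 = 1]: the determinant is the
   upper left entry. *)
rewrite -C1B P1B C1B -(mulmxA C1) Blam mulmx0 -/(block_mx _ _ _ _) det_ublock det1 mulr1 det_mx11.
by rewrite /lam colE mulmxA -colE mxE.
Qed.

(** For the tangent forms T0, T1, membership reads b T0 - a T1 = h (a' a + b' b). The syzygy lemma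
    gives T0 = a w + h b' and T1 = b w - h a', which is the Leibniz rule along (h + t w) (a + t b',
    b - t a'). *)
Lemma sylvester_tangent v : (k *m tsylv v <= B)%MS -> in_tangent X y0 v.
Proof.
case/submxP => u E; have := congr1 rVpoly E.
rewrite row_mul_sylvester ?size_polyN // mul_sylvester ya yb.
set a' := rVpoly (lsubmx u); set b' := rVpoly (rsubmx u).
have sa' : (size a' <= m.+1)%N by apply: size_rVpoly.
have sb' : (size b' <= m.+1)%N by apply: size_rVpoly.
have st j : (size (tangent_form p v j) <= d.+1)%N by apply: size_tangent_form.
have sad (c e : {poly F}) (i j : nat) : (size c <= i.+1)%N -> (size e <= j.+1)%N -> (i + j = d)%N ->
    (size (c * e)%R <= d.+1)%N.
  by move=> sc se <-; apply: size_mul_le.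
have sad' (c e : {poly F}) (i j : nat) : (size c <= i.+1)%N -> (size e <= j.+1)%N -> (i + j = d + m)%N ->
    (size (c * e)%R <= (d + m).+1)%N.
  by move=> sc se <-; apply: size_mul_le.
have sB (f g : {poly F}) n : (size f <= n)%N -> (size g <= n)%N -> (size (f + g)%R <= n)%N.
  by move=> sf sg; apply: leq_trans (size_polyD _ _) _; rewrite geq_max sf.
rewrite !poly_rV_K; last 2 first.
- apply: sB; [apply: (sad' _ _ m d) => // | apply: (sad' _ _ m d) => //]; rewrite ?(sad _ _ l m) //; lia.
- apply: sB; [apply: (sad' _ _ m d) => // | apply: (sad' _ _ m d) => //]; rewrite ?size_polyN //; lia.
move=> E1.
have E2 : a * (tangent_form p v q1 + h * a') = b * (tangent_form p v q0 - h * b').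
  apply/eqP; rewrite -subr_eq0; apply/eqP.
  transitivity (a' * (h * a) + b' * (h * b) - (b * tangent_form p v q0 + - a * tangent_form p v q1)); first by ring.
  by rewrite -E1 subrr.
have s1 : (size (tangent_form p v q1 + h * a')%R <= (m + l).+1)%N.
  by rewrite addnC -dlm; apply: sB => //; apply: (sad _ _ l m).
have s2 : (size (tangent_form p v q0 - h * b')%R <= (m + l).+1)%N.
  by rewrite addnC -dlm; apply: sB => //; rewrite size_polyN; apply: (sad _ _ l m).
have [w [sw w1 w2]] := coprime_syzygy cab (esym E2) s2 s1.
rewrite -(direction_tangent_form hd pq y0 v).
have := @normalize_tangent F d p q hd pq X y0 (line h w * line a b') (line h w * line b (- a')).
rewrite !dparamM !dparam_line !at_paramM !at_param_line !scale0r !addr0.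
have -> : w * a + h * b' = tangent_form p v q0.
  by rewrite [w * a]mulrC -w1 subrK.
have -> : w * b + h * - a' = tangent_form p v q1.
  by rewrite [w * b]mulrC -w2 mulrN addrK.
apply=> // t; rewrite !at_paramM !at_param_line => Dt.
have sZ (f g : {poly F}) n : (size f <= n)%N -> (size g <= n)%N -> (size (f + t *: g)%R <= n)%N.
  by move=> sf sg; apply: sB => //; apply: leq_trans (size_scale_leq _ _) _.
have := @normalize_common_factor d p q hd pq F 1 l m (h + t *: w) (a + t *: b') (b + t *: - a').
rewrite !mul1r; apply=> //; try by apply: sZ; rewrite ?size_polyN.
- by apply: (sad _ _ l m) => //; apply: sZ.
- by apply: (sad _ _ l m) => //; apply: sZ; rewrite ?size_polyN.
Qed.

(** The codimension is the rank of [v |-> k *m tsylv v] modulo the rows of [B]. By [bezout_forms]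
    this map is onto the quotient, of dimension (d + m + 1) - (2 m + 1) = l. *)
Lemma dim_tangent_coprime : \dim (tangent_space X y0) = (N - l)%N.
Proof.
have [L LE] : exists L : 'M[F]_(N, (d + m).+1), forall v, k *m tsylv v = v *m L.
  apply: linear_mx => c u v.
  have -> : tsylv (c *: u + v) = tsylv v + c *: tsylv u.
    by rewrite /tsylv -sylvesterDZ !tangent_form_linear ![_ *: _ + _]addrC.
  by rewrite addrC mulmxDr -scalemxAr addrC.
have TE v : v \in tangent_space X y0 <-> (v <= kermx (L *m cokermx B))%MS.
  rewrite mem_tangent_space; split=> [/tangent_sylvester|H].
    by rewrite LE submxE => /eqP H; apply/sub_kermxP; rewrite mulmxA.
  by apply: sylvester_tangent; rewrite LE submxE -mulmxA; apply/eqP/sub_kermxP.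
rewrite (dim_vspace_rowspace TE) mxrank_ker; congr (_ - _)%N.
have full (e : 'rV[F]_(d + m).+1) : (e <= L + B)%MS.
  have se : (size (rVpoly e) <= (m + d).+1)%N by rewrite [(m + d)%N]addnC; apply: size_rVpoly.
  have [|u [v [su sv E]]] := bezout_forms cab _ se; first by rewrite dlm leq_addl.
  pose dl := direction p q hd y0 u v.
  have := @tangent_form_direction F d p q hd pq y0 u v true su sv; rewrite -/dl /= => Eu.
  have := @tangent_form_direction F d p q hd pq y0 u v false su sv; rewrite -/dl /= => Ev.
  (* The part of [(u, v)] in the span of the forms of [y0] contributes an element of the row space
     of [B]; [a'] and [b'] are its multipliers. *)
  pose a' := u`_(q q0) *: b - v`_(q q0) *: a; pose b' := u`_(q q1) *: b - v`_(q q1) *: a.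
  have sa' : (size a' <= m.+1)%N by apply: size_lin.
  have sb' : (size b' <= m.+1)%N by apply: size_lin.
  have eE : e = k *m tsylv dl + row_mx (poly_rV a') (poly_rV b') *m B.
    rewrite !row_mul_sylvester ?size_polyN // -raddfD -[LHS]rVpolyK; congr poly_rV.
    rewrite E {1}Eu {1}Ev /a' /b' -!mul_polyC; ring.
  by rewrite eE LE addmx_sub_adds ?submxMl.
apply/eqP; rewrite eqn_leq; apply/andP; split.
  apply: leq_trans (mxrankM_maxr _ _) _.
  by rewrite mxrank_coker rank_sylv_coprime; lia.
have : (cokermx B <= L *m cokermx B)%MS.
  have /sub_addsmxP[u E] : (1%:M <= L + B)%MS by apply/row_subP => i; apply: full.
  rewrite -[X in (X <= _)%MS]mul1mx E mulmxDl -!mulmxA mulmx_coker mulmx0 addr0.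
  exact: submxMl.
move/mxrankS; rewrite mxrank_coker rank_sylv_coprime; apply: leq_trans; lia.
Qed.

End SmoothTangent.

(** * Finitely many parametrisations and the upper bound *)

Section NormalizedForms.
Variable A : comNzRingType.

(* Slices for the scaling of the common divisor and, in the next two definitions,
   for the action of GL_2 on the pair of its cofactors. *)
Definition monic_at n (c : 'I_n.+1) (t : 'I_n -> A) : {poly A} :=
  'X^c + \sum_(i < n) t i *: 'X^(lift c i).

Definition monic_at2 n (c : 'I_n.+2) (e : 'I_n.+1) (t : 'I_n -> A) : {poly A} :=
  'X^c + \sum_(i < n) t i *: 'X^(lift c (lift e i)).

Definition monic_at2' n (c : 'I_n.+2) (e : 'I_n.+1) (t : 'I_n -> A) : {poly A} :=
  'X^(lift c e) + \sum_(i < n) t i *: 'X^(lift c (lift e i)).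

Lemma poly_sum_coef n (f : {poly A}) : (size f <= n)%N -> f = \sum_(i < n) f`_i *: 'X^i.
Proof.
move=> sf; rewrite -(poly_def n (fun i => f`_i)); apply/polyP => i; rewrite coef_poly.
by case: ltnP => // ni; rewrite nth_default //; apply: leq_trans ni.
Qed.

Lemma monic_atP n (c : 'I_n.+1) (f : {poly A}) : (size f <= n.+1)%N -> f`_c = 1 ->
  f = monic_at c (fun i : 'I_n => f`_(lift c i)).
Proof.
by move=> sf fc; rewrite {1}(poly_sum_coef sf) (bigD1_ord c) //= fc scale1r.
Qed.

Lemma monic_at2P n (c : 'I_n.+2) e (f : {poly A}) : (size f <= n.+2)%N -> f`_c = 1 ->
  f`_(lift c e) = 0 ->
  f = monic_at2 c e (fun i : 'I_n => f`_(lift c (lift e i))).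
Proof.
move=> sf fc fe; rewrite {1}(poly_sum_coef sf) (bigD1_ord c) //= fc scale1r.
by rewrite (bigD1_ord e) //= fe scale0r add0r.
Qed.

Lemma monic_at2P' n (c : 'I_n.+2) e (f : {poly A}) : (size f <= n.+2)%N -> f`_c = 0 ->
  f`_(lift c e) = 1 ->
  f = monic_at2' c e (fun i : 'I_n => f`_(lift c (lift e i))).
Proof.
move=> sf fc fe; rewrite {1}(poly_sum_coef sf) (bigD1_ord c) //= fc scale0r add0r.
by rewrite (bigD1_ord e) //= fe scale1r.
Qed.

End NormalizedForms.

Lemma map_monic_sum (A B : comNzRingType) (ev : {rmorphism A -> B}) n (t : 'I_n -> A)
    (k0 : nat) (k : 'I_n -> nat) :
  map_poly ev ('X^k0 + \sum_(i < n) t i *: 'X^(k i)) =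
  'X^k0 + \sum_(i < n) ev (t i) *: 'X^(k i).
Proof.
rewrite rmorphD rmorph_sum /= map_polyXn; congr (_ + _).
by apply: eq_bigr => i _; rewrite map_polyZ map_polyXn.
Qed.

Section UpperBound.
Variables (F : closedFieldType) (d : nat).
Variables (p : 'I_d.-1 -> 'I_d.+1) (q : 'I_(d.+1 - d.-1) -> 'I_d.+1).
Hypothesis hd : (2 <= d)%N.
Hypothesis pq : chart_index p q.
Notation q0 := (q0 hd).
Notation q1 := (q1 hd).
Notation form := (chart_form p q).
Notation pivot := (chart_pivot q hd).
Notation numer := (chart_numer p q hd).
Notation normalize := (normalize p q hd).
Notation common_factor := (@common_factor d p q hd F).
Notation N := (d.-1 * (d.+1 - d.-1))%N.
Implicit Types (a b e f g h u w : {poly F}) (y v : 'rV[F]_N).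

Lemma pivot_mix (x1 x2 x3 x4 : F) f g :
  pivot (x1 *: f + x2 *: g) (x3 *: f + x4 *: g) = (x1 * x4 - x2 * x3) * pivot f g.
Proof. by rewrite /chart_pivot !(coefD, coefZ); ring. Qed.

Lemma numer_mix (x1 x2 x3 x4 : F) f g :
  numer (x1 *: f + x2 *: g) (x3 *: f + x4 *: g) = (x1 * x4 - x2 * x3) *: numer f g.
Proof.
rewrite /chart_numer -linearZ; congr mxvec; apply/matrixP => i j; rewrite !mxE.
by case: ifP => _; rewrite !(coefD, coefZ); ring.
Qed.

Lemma independent_minor m a b : (size a <= m.+2)%N -> (size b <= m.+2)%N -> a != 0 ->
  (forall c : F, b != c *: a) ->
  exists (c : 'I_m.+2) (e : 'I_m.+1), a`_c * b`_(lift c e) - a`_(lift c e) * b`_c != 0.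
Proof.
move=> sa sb a0 nab.
have [c ac] : exists c : 'I_m.+2, a`_c != 0.
  have lt : ((size a).-1 < m.+2)%N by rewrite prednK // size_poly_gt0.
  by exists (Ordinal lt) => /=; rewrite -[_`_ _]/(lead_coef a) lead_coef_eq0.
exists c; apply: contrapT => /forallNP H.
have /eqP := nab (b`_c / a`_c); apply; apply/polyP => i; rewrite coefZ.
have [il|il] := ltnP i m.+2; last first.
  by rewrite (nth_default _ (leq_trans sa il)) (nth_default _ (leq_trans sb il)) mulr0.
rewrite -[(i)]/(nat_of_ord (Ordinal il)).
have [e ->|->] := unliftP c (Ordinal il); last by rewrite divfK.
have /negP := H e; rewrite negbK subr_eq0 => /eqP E.
by apply: (mulfI ac); rewrite E; field.
Qed.

Variables (l m : nat).
Hypothesis dlm : d = (l + m.+1)%N.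

(** [J] lists the positions of the normalised coefficients: one for [h], which leaves l parameters,
    and a pair of columns where [(a, b)] becomes the identity, which leaves m for each of [a] and
    [b]. *)
Lemma chain_length_common_factor x r :
  chain_lengths (common_factor 1 l m.+1) x r -> (r <= l + (m + m))%N.
Proof.
pose J := ('I_l.+1 * ('I_m.+2 * 'I_m.+1))%type.
pose ph (A : comNzRingType) (j : J) (t : 'I_(l + (m + m)) -> A) :=
  monic_at j.1 (fun i => t (lshift _ i)).
pose pa (A : comNzRingType) (j : J) (t : 'I_(l + (m + m)) -> A) :=
  monic_at2 j.2.1 j.2.2 (fun i => t (rshift _ (lshift _ i))).
pose pb (A : comNzRingType) (j : J) (t : 'I_(l + (m + m)) -> A) :=
  monic_at2' j.2.1 j.2.2 (fun i => t (rshift _ (rshift _ i))).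
pose V (i : 'I_(l + (m + m))) : {mpoly F[l + (m + m)]} := 'X_i.
apply: (@chain_length_bound F _ _ J _ _ _
  (fun j i => numer (ph _ j V * pa _ j V) (ph _ j V * pb _ j V) ord0 i)
  (fun j => pivot (ph _ j V * pa _ j V) (ph _ j V * pb _ j V))).
move=> y [h [a [b [sh sa sb]]]]; rewrite mul1r => ya yb.
have h0 : h != 0.
  by apply: contraNneq (chart_form_neq0 pq y q0) => h0; rewrite ya h0 mul0r.
have a0 : a != 0.
  by apply: contraNneq (chart_form_neq0 pq y q0) => a0; rewrite ya a0 mulr0.
have nab (c : F) : b != c *: a.
  apply/eqP => bca; have := coef_form_q pq y q1 q1.
  rewrite yb bca -scalerAr -ya coefZ (coef_form_q pq) eqxx eq_sym q10 mulr0.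
  by move/esym/eqP; rewrite oner_eq0.
have [c [e dl]] := independent_minor sa sb a0 nab.
set delta := _ - _ in dl.
have [k hk] : exists k : 'I_l.+1, h`_k != 0.
  have lt : ((size h).-1 < l.+1)%N by rewrite prednK // size_poly_gt0.
  by exists (Ordinal lt) => /=; rewrite -[_`_ _]/(lead_coef h) lead_coef_eq0.
pose h1 := (h`_k)^-1 *: h.
pose a1 := delta^-1 *: (b`_(lift c e) *: a - a`_(lift c e) *: b).
pose b1 := delta^-1 *: (a`_c *: b - b`_c *: a).
have sz z n (u : {poly F}) : (size u <= n)%N -> (size (z *: u)%R <= n)%N.
  by move=> su; apply: leq_trans (size_scale_leq _ _) su.
pose t (i : 'I_(l + (m + m))) : F := match split i with
  | inl i => h1`_(lift k i)
  | inr i => match split i with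
    | inl i => a1`_(lift c (lift e i)) | inr i => b1`_(lift c (lift e i)) end end.
pose j : J := (k, (c, e)).
have th : ph _ j t = h1.
  rewrite [RHS](@monic_atP _ _ k) ?sz // ?coefZ ?mulVf //; congr (_ + _).
  by apply: eq_bigr => i _; rewrite /t (unsplitK (inl _)).
have ta : pa _ j t = a1.
  rewrite [RHS](@monic_at2P _ _ c e) ?sz ?size_lin //; last 2 first.
  - by rewrite !(coefZ, coefB) /delta; field.
  - by rewrite !(coefZ, coefB); ring.
  congr (_ + _); apply: eq_bigr => i _.
  by rewrite /t (unsplitK (inr _)) (unsplitK (inl _)).
have tb : pb _ j t = b1.
  rewrite [RHS](@monic_at2P' _ _ c e) ?sz ?size_lin //; last 2 first.
  - by rewrite !(coefZ, coefB); ring.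
  - by rewrite !(coefZ, coefB) /delta; field.
  congr (_ + _); apply: eq_bigr => i _.
  by rewrite /t (unsplitK (inr _)) (unsplitK (inr _)).
have Vt : (fun i => (V i).@[t]) = t by apply/funext => i; rewrite /V mevalXU.
have eh : map_poly (meval t) (ph _ j V) = h1.
  by rewrite -th -[in RHS]Vt; apply: map_monic_sum.
have ea : map_poly (meval t) (pa _ j V) = a1.
  by rewrite -ta -[in RHS]Vt; apply: map_monic_sum.
have eb : map_poly (meval t) (pb _ j V) = b1.
  by rewrite -tb -[in RHS]Vt; apply: map_monic_sum.
(* The normalised pencil is an invertible combination of the forms of [y]; numerators and pivot are
   both multiplied by its determinant, so the point is unchanged. *)
pose s := (h`_k)^-1 * delta^-1.
have E0 : h1 * a1 = (s * b`_(lift c e)) *: form y q0 + (- s * a`_(lift c e)) *: form y q1.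
  by rewrite ya yb /h1 /a1 /s -!mul_polyC; ring.
have E1 : h1 * b1 = (- s * b`_c) *: form y q0 + (s * a`_c) *: form y q1.
  by rewrite ya yb /h1 /b1 /s -!mul_polyC; ring.
have sdet : (s * b`_(lift c e)) * (s * a`_c) - (- s * a`_(lift c e)) * (- s * b`_c) != 0.
  rewrite (_ : _ - _ = s * s * delta); last by rewrite /delta; ring.
  by rewrite !mulf_neq0 ?invr_eq0.
have Dt : (pivot (ph _ j V * pa _ j V) (ph _ j V * pb _ j V)).@[t] =
    s * b`_(lift c e) * (s * a`_c) - - s * a`_(lift c e) * (- s * b`_c).
  rewrite (map_pivot q hd (meval t)) !rmorphM /= eh ea eb E0 E1.
  by rewrite pivot_mix (pivot_form hd pq) mulr1.
exists j, t; rewrite Dt; split=> //.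
apply/rowP => i; rewrite mxE.
have -> : (numer (ph _ j V * pa _ j V) (ph _ j V * pb _ j V) ord0 i).@[t] =
    map_mx (meval t) (numer (ph _ j V * pa _ j V) (ph _ j V * pb _ j V)) ord0 i.
  by rewrite mxE.
rewrite map_numer !rmorphM /= eh ea eb E0 E1 numer_mix (numer_form hd pq) mxE.
by rewrite mulrC mulKf.
Qed.

End UpperBound.

(** * A chain of maximal length *)

Section AffineFlag.
Variables (F : closedFieldType) (n e : nat) (x : 'rV[F]_n) (M : 'M[F]_(e, n)).

Definition affine_flag (i : nat) : set 'rV[F]_n :=
  [set y | exists2 c : 'rV[F]_e, (forall j : 'I_e, (i <= j)%N -> c ord0 j = 0) & y = x + c *m M].

Lemma affine_flag_base i : affine_flag i x.
Proof. by exists 0 => [j _|]; rewrite ?mxE // mul0mx addr0. Qed.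

Lemma affine_flag_prime i : prime_set (affine_flag i).
Proof.
apply: curve_connected_prime; first by exists x; apply: affine_flag_base.
move=> y1 y2 [c1 c10 ->] [c2 c20 ->].
pose N k : {poly F} := ((x + c1 *m M) ord0 k)%:P + (((c2 - c1) *m M) ord0 k) *: 'X.
have NE t : curve_at N 1 t = x + (c1 + t *: (c2 - c1)) *m M.
  rewrite mulmxDl -scalemxAl addrA /N; move: (x + c1 *m M) ((c2 - c1) *m M) => A B.
  by apply/rowP => k; rewrite !mxE hornerC divr1 hornerD hornerZ hornerX hornerC mulrC.
exists N, 1; rewrite !NE !hornerC oner_neq0 scale0r addr0 scale1r (addrC c1) subrK; split=> //.
move=> t _; rewrite NE; exists (c1 + t *: (c2 - c1)) => // j ij.
by rewrite !mxE c10 // c20 //; ring.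
Qed.

Lemma affine_flag_sub i : affine_flag i `<=` affine_flag i.+1.
Proof. by move=> y [c c0 ->]; exists c => // j ij; apply: c0; apply: ltnW. Qed.

Lemma affine_flag_separation i : row_free M -> (i < e)%N ->
  exists2 f, vanishing_ideal (affine_flag i) f & ~ vanishing_ideal (affine_flag i.+1) f.
Proof.
move=> /row_freeP[R MR] ie; pose i0 := Ordinal ie.
pose f : {mpoly F[n]} := \sum_k R k i0 *: ('X_k - (x ord0 k)%:MP).
have fE c : f.@[(x + c *m M) ord0] = c ord0 i0.
  rewrite -[c in RHS]mulmx1 -MR mulmxA [RHS]mxE raddf_sum /=; apply: eq_bigr => k _.
  by rewrite mevalZ mevalB mevalXU mevalC mxE addrAC subrr add0r mulrC.
exists f; first by move=> y [c c0 ->]; rewrite fE c0.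
move=> /(_ (x + delta_mx ord0 i0 *m M)); rewrite fE mxE !eqxx => H.
have /eqP : 1 = 0 :> F.
  apply: H; exists (delta_mx ord0 i0) => // j ij; rewrite mxE.
  by case: (j =P i0) ij => [->|]; rewrite ?ltnn // andbF.
by rewrite oner_eq0.
Qed.

End AffineFlag.

Section LowerBound.
Variables (F : closedFieldType) (d : nat).
Variables (p : 'I_d.-1 -> 'I_d.+1) (q : 'I_(d.+1 - d.-1) -> 'I_d.+1).
Hypothesis hd : (2 <= d)%N.
Hypothesis pq : chart_index p q.
Notation q0 := (q0 hd).
Notation q1 := (q1 hd).
Notation form := (chart_form p q).
Notation pivot := (chart_pivot q hd).
Notation numer := (chart_numer p q hd).
Notation normalize := (normalize p q hd).
Notation common_factor := (@common_factor d p q hd F).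
Notation N := (d.-1 * (d.+1 - d.-1))%N.
Implicit Types (a b e f g h u w z : {poly F}) (x y v : 'rV[F]_N).

Lemma normalize_combination f g : (size f <= d.+1)%N -> (size g <= d.+1)%N ->
  pivot f g != 0 ->
  f = f`_(q q0) *: form (normalize f g) q0 + f`_(q q1) *: form (normalize f g) q1 /\
  g = g`_(q q0) *: form (normalize f g) q0 + g`_(q q1) *: form (normalize f g) q1.
Proof.
move=> sf sg D0; rewrite (form_normalize0 pq) // (form_normalize1 pq) //.
by split; rewrite !scalerBr !scalerA -[LHS]scale1r -(mulVf D0) {1}/chart_pivot;
  rewrite -!mul_polyC !(rmorphB, rmorphM) /=; ring.
Qed.

(** Two points are joined by the image of the segment between their parameters [(h, a, b)]. *)
Lemma common_factor_prime e j m : common_factor e j m !=set0 ->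
  (forall h a, (size h <= j.+1)%N -> (size a <= m.+1)%N -> (size (e * h * a)%R <= d.+1)%N) ->
  prime_set (common_factor e j m).
Proof.
move=> ne sd; apply: curve_connected_prime => // y1 y2.
move=> [h1 [a1 [b1 [sh1 sa1 sb1 f1 g1]]]] [h2 [a2 [b2 [sh2 sa2 sb2 f2 g2]]]].
pose f := map_poly polyC e * line h1 (h2 - h1) * line a1 (a2 - a1).
pose g := map_poly polyC e * line h1 (h2 - h1) * line b1 (b2 - b1).
have fE t : at_param t f = e * (h1 + t *: (h2 - h1)) * (a1 + t *: (a2 - a1)).
  by rewrite !at_paramM at_param_const !at_param_line.
have gE t : at_param t g = e * (h1 + t *: (h2 - h1)) * (b1 + t *: (b2 - b1)).
  by rewrite !at_paramM at_param_const !at_param_line.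
have f0E : at_param 0 f = form y1 q0 by rewrite fE !scale0r !addr0.
have g0E : at_param 0 g = form y1 q1 by rewrite gE !scale0r !addr0.
have f1E : at_param 1 f = form y2 q0 by rewrite fE !scale1r !(addrC _ (_ - _)) !subrK.
have g1E : at_param 1 g = form y2 q1 by rewrite gE !scale1r !(addrC _ (_ - _)) !subrK.
exists (fun i => numer f g ord0 i), (chart_pivot q hd f g); rewrite !horner_pivot !curve_normalize.
rewrite f0E g0E f1E g1E !(pivot_form hd pq) !(normalize_form hd pq) oner_neq0; split=> // t.
rewrite horner_pivot curve_normalize fE gE => Dt.
have sl n (u1 u2 : {poly F}) : (size u1 <= n)%N -> (size u2 <= n)%N ->
    (size (u1 + t *: (u2 - u1))%R <= n)%N.
  move=> s1 s2; apply: leq_trans (size_polyD _ _) _; rewrite geq_max s1 /=.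
  apply: leq_trans (size_scale_leq _ _) _; apply: leq_trans (size_polyD _ _) _.
  by rewrite geq_max size_polyN s1 s2.
by apply: normalize_common_factor => //; try apply: sd; apply: sl.
Qed.

Lemma common_factorS e z j m : (size z <= 2)%N ->
  common_factor (z * e) j m `<=` common_factor e j.+1 m.
Proof.
move=> sz y [h [a [b [sh sa sb f g]]]]; exists (z * h), a, b; split=> //.
- by have := @size_mul_le _ z h 1 j sz sh; rewrite add1n.
- by rewrite f; ring.
- by rewrite g; ring.
Qed.

(** Divisibility by [e] with bounded quotient is membership in the row space of [M], a linear
    condition; an entry of the product with [cokermx M] detects its failure at [y]. *)
Lemma divisible_separation e k (Y Y' : set 'rV[F]_N) y : Y' y ->
  (forall u, (size u <= k.+1)%N -> (size (e * u)%R <= d.+1)%N) ->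
  (forall y, Y y -> forall j, exists2 u : {poly F}, (size u <= k.+1)%N & form y j = e * u) ->
  (forall u w, (size u <= k.+1)%N -> (size w <= k.+1)%N ->
     form y q0 = e * u -> form y q1 = e * w -> False) ->
  exists2 f, vanishing_ideal Y f & ~ vanishing_ideal Y' f.
Proof.
move=> Yy se Ydiv ndiv; pose M := mulmat k d.+1 e.
have [j nj] : exists j, ~ (poly_rV (form y j) <= M)%MS.
  apply: contrapT => /forallNP H.
  have HM j : exists2 u : {poly F}, (size u <= k.+1)%N & form y j = e * u.
    have /contrapT/submxP[w E] := H j; exists (rVpoly w); first exact: size_rVpoly.
    move: E; rewrite mul_mulmat => /(congr1 rVpoly).
    by rewrite mulrC !poly_rV_K ?size_form // se // size_rVpoly.
  have [u su eu] := HM q0; have [v sv ev] := HM q1; exact: (ndiv u v).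
have [t nt] : exists t, (poly_rV (form y j) *m cokermx M) ord0 t != 0.
  apply: contrapT => /forallNP H; apply: nj; rewrite submxE; apply/eqP/rowP => t.
  by rewrite [RHS]mxE; apply/eqP; rewrite -[_ == _]negbK; apply/negP/H.
pose V : 'rV[{mpoly F[N]}]_N := \row_i 'X_i.
pose f := (poly_rV (chart_form p q V j) *m map_mx (@mpolyC N F) (cokermx M)) ord0 t.
have fE (z : 'rV[F]_N) : f.@[z ord0] = (poly_rV (form z j) *m cokermx M) ord0 t.
  have -> : f.@[z ord0] = (map_mx (meval (z ord0)) (poly_rV (chart_form p q V j) *m
      map_mx (@mpolyC N F) (cokermx M))) ord0 t by rewrite mxE.
  rewrite map_mxM map_poly_rV map_form -map_mx_comp; congr ((poly_rV (chart_form p q _ j) *m _) _ _).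
    by apply/rowP => i; rewrite !mxE /= mevalXU.
  by apply/matrixP => ? ?; rewrite mxE /= mevalC.
exists f.
  move=> z Yz; rewrite fE; have [u su eu] := Ydiv z Yz j.
  have /eqP -> : poly_rV (form z j) *m cokermx M == 0.
    by rewrite -submxE eu mulrC -(poly_rV_K su) -mul_mulmat submxMl.
  by rewrite mxE.
by move/(_ y Yy); rewrite fE => /eqP; apply/negP.
Qed.

(** The divisor [z * g] is perturbed to [z * g + t *: w] so that it loses the zero of [z]: [w = 1]
    for a finite root, and [w] of full degree [j.+1] for the zero at infinity. As [a] and [b] have
    no common zero, [z * e] no longer divides the pencil. *)
Lemma common_factor_separation x e z g a b k j m : d = (k + j.+1 + m.+1)%N ->
  (size e <= k.+1)%N -> (size g <= j.+1)%N -> coprime_forms m.+1 a b ->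
  z = 1 \/ (exists r, z = 'X - r%:P) ->
  form x q0 = z * e * g * a -> form x q1 = z * e * g * b ->
  exists2 f, vanishing_ideal (common_factor (z * e) j m.+1) f &
             ~ vanishing_ideal (common_factor e j.+1 m.+1) f.
Proof.
move=> dk se sg cab zE xa xb.
have [sa sb] : (size a <= m.+2)%N /\ (size b <= m.+2)%N by case: cab => _; lia.
have e0 : e != 0.
  by apply: contraNneq (chart_form_neq0 pq x q0) => e0; rewrite xa e0 mulr0 !mul0r.
have z0 : z != 0.
  by apply: contraNneq (chart_form_neq0 pq x q0) => z0; rewrite xa z0 !mul0r.
have sz : (size z <= 2)%N.
  by case: zE => [->|[r ->]]; rewrite ?size_poly1 ?size_XsubC.
have szg : (size (z * g)%R <= j.+2)%N.
  by have := @size_mul_le _ z g 1 j sz sg; rewrite add1n.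
have [w [sw Hw]] : exists w : {poly F}, (size w <= j.+2)%N /\ forall t a' b', t != 0 ->
    (size a' <= (j + m.+1).+1)%N -> (size b' <= (j + m.+1).+1)%N ->
    (z * g + t *: w) * a = z * a' -> (z * g + t *: w) * b = z * b' -> False.
  case: zE => [z1|[r zr]].
    exists 'X^(j.+1); rewrite size_polyXn; split=> // t a' b' t0 sa' sb' Ea Eb.
    have sc (u u' : {poly F}) : (size u' <= (j + m.+1).+1)%N ->
        (z * g + t *: 'X^(j.+1)) * u = z * u' -> (size u <= m.+1)%N.
      move=> su' E; apply: (@size_mul_inv _ (z * g + t *: 'X^(j.+1)) _ j.+1); last first.
        by rewrite E z1 mul1r (leq_trans su') // addnS addSn.
      rewrite z1 mul1r addrC size_polyDl size_scale // size_polyXn //.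
    have := sc _ _ sa' Ea; have := sc _ _ sb' Eb; case: cab => _.
    by move: (size a) (size b) => s1 s2; lia.
  exists 1; rewrite size_poly1; split=> // t a' b' t0 _ _ Ea Eb.
  have rc (u u' : {poly F}) : (z * g + t *: 1) * u = z * u' -> root u r.
    move=> /(congr1 (fun f : {poly F} => f.[r])).
    rewrite !hornerM hornerD hornerM hornerZ hornerC zr hornerXsubC subrr !mul0r add0r mulr1.
    by move/eqP; rewrite mulf_eq0 (negPf t0).
  have [cop _] := cab; have := root_gcd a b r.
  rewrite (rc _ _ Ea) (rc _ _ Eb) /=; move: cop; rewrite -gcdp_eqp1 => /eqp_root ->.
  by rewrite (negPf (root1 _)).
pose f := map_poly polyC e * line (z * g) w * map_poly polyC a.
pose f' := map_poly polyC e * line (z * g) w * map_poly polyC b.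
have fE t : at_param t f = e * (z * g + t *: w) * a.
  by rewrite !at_paramM !at_param_const !at_param_line.
have fE' t : at_param t f' = e * (z * g + t *: w) * b.
  by rewrite !at_paramM !at_param_const !at_param_line.
have D0 : (chart_pivot q hd f f').[0] = 1.
  rewrite horner_pivot fE fE' scale0r addr0 -(pivot_form hd pq x) xa xb.
  by congr (chart_pivot q hd _ _); ring.
have : 'X * chart_pivot q hd f f' != 0.
  rewrite mulf_neq0 ?polyX_eq0 //; apply/eqP => E; move: D0; rewrite E horner0.
  by move/esym/eqP; rewrite oner_eq0.
(* The pivot is 1 at parameter 0, so some nonzero [t] keeps the pencil in the chart. *)
case/closed_nonrootP => t; rewrite rootE hornerM hornerX mulf_eq0 negb_or => /andP[t0 Dt].
move: Dt; rewrite horner_pivot fE fE'; set ft := e * _ * a; set gt := e * _ * b => Dt.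
have szt : (size (z * g + t *: w)%R <= j.+2)%N.
  by apply: leq_trans (size_polyD _ _) _; rewrite geq_max szg (leq_trans (size_scale_leq _ _)).
have sft (u : {poly F}) : (size u <= m.+2)%N -> (size (e * (z * g + t *: w) * u)%R <= d.+1)%N.
  by move=> su; rewrite dk; apply: size_mul_le => //; apply: size_mul_le.
have [Ef Eg] := normalize_combination (sft _ sa) (sft _ sb) Dt.
apply: (@divisible_separation (z * e) (j + m.+1) _ _ (normalize ft gt)).
- by apply: normalize_common_factor => //; apply: sft.
- move=> u su; rewrite (_ : d = (1 + k + (j + m.+1))%N); last by rewrite dk; lia.
  by apply: size_mul_le => //; apply: size_mul_le.
- move=> y [h' [a' [b' [sh' sa' sb' ya yb]]]] i.
  have [->|->] := q01 hd i; [exists (h' * a') | exists (h' * b')];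
    by rewrite ?size_mul_le // mulrA.
move=> u v su sv Eu Ev; rewrite Eu Ev in Ef Eg.
have sl (x1 x2 : F) : (size (x1 *: u + x2 *: v)%R <= (j + m.+1).+1)%N.
  apply: leq_trans (size_polyD _ _) _.
  by rewrite geq_max !(leq_trans (size_scale_leq _ _)).
apply: (Hw t _ _ t0 (sl ft`_(q q0) ft`_(q q1)) (sl gt`_(q q0) gt`_(q q1))).
- apply: (mulfI e0); transitivity ft; first by rewrite /ft; ring.
  by apply: etrans Ef _; move: ft`_(q q0) ft`_(q q1) => c1 c2; rewrite -!mul_polyC; ring.
- apply: (mulfI e0); transitivity gt; first by rewrite /gt; ring.
  by apply: etrans Eg _; move: gt`_(q q0) gt`_(q q1) => c1 c2; rewrite -!mul_polyC; ring.
Qed.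

Variables (l m : nat).
Hypothesis dlm : d = (l + m.+1)%N.

(** Divisibility by [h] imposes at most l conditions, the corank of [H], on each of the two forms,
    and N - 2 l = 2 m. *)
Lemma divisible_tangents h : h != 0 -> (size h <= l.+1)%N ->
  exists (e : nat) (M : 'M[F]_(e, N)), [/\ row_free M, (m + m <= e)%N &
    forall c j, exists2 u : {poly F}, (size u <= m.+2)%N & tangent_form p (c *m M) j = h * u].
Proof.
move=> h0 sh; pose H := mulmat m.+1 d.+1 h.
have suh (u : {poly F}) : (size u <= m.+2)%N -> (size (u * h)%R <= d.+1)%N.
  by move=> su; rewrite dlm addnC; apply: size_mul_le.
have rH : \rank H = m.+2.
  apply/eqP; change (row_free H); rewrite -kermx_eq0; apply/rowV0P => u /sub_kermxP.
  rewrite mul_mulmat => /(congr1 rVpoly); rewrite raddf0 poly_rV_K ?suh ?size_rVpoly //.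
  move/eqP; rewrite mulf_eq0 (negPf h0) orbF => /eqP /(congr1 (@poly_rV _ m.+2)).
  by rewrite rVpolyK raddf0.
have [L LE] : exists L, forall v, row_mx (poly_rV (tangent_form p v q0)) (poly_rV (tangent_form p v q1)) =
    v *m L :> 'rV[F]_(d.+1 + d.+1).
  apply: linear_mx => c u v; rewrite scale_row_mx add_row_mx !tangent_form_linear.
  by rewrite !linearD !linearZ.
pose K := L *m block_mx (cokermx H) 0 0 (cokermx H).
exists (\rank (kermx K)), (row_base (kermx K)); split; first exact: row_base_free.
  rewrite mxrank_ker; have : (\rank K <= l + l)%N.
    apply: leq_trans (mxrankM_maxr _ _) _.
    by rewrite rank_diag_block_mx !mxrank_coker rH; lia.
  move: (\rank K) => r; rewrite {1}dlm; lia.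
move=> c j; set v := c *m _.
have vK : v *m K = 0.
  by apply/sub_kermxP; rewrite -(eq_row_base (kermx K)) submxMl.
have : (poly_rV (tangent_form p v j) <= H)%MS.
  rewrite submxE; move: vK; rewrite /K mulmxA -LE mul_row_block !mulmx0 addr0 add0r => E.
  have [->|->] := q01 hd j; apply/eqP.
    by rewrite -(row_mxKl (poly_rV (tangent_form p v q0) *m cokermx H)
      (poly_rV (tangent_form p v q1) *m cokermx H)) E raddf0.
  by rewrite -(row_mxKr (poly_rV (tangent_form p v q0) *m cokermx H)
      (poly_rV (tangent_form p v q1) *m cokermx H)) E raddf0.
case/submxP => w; rewrite mul_mulmat => /(congr1 rVpoly).
rewrite !poly_rV_K ?size_tangent_form ?suh ?size_rVpoly // => ->.
by exists (rVpoly w); rewrite ?size_rVpoly // mulrC.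
Qed.

(* The flag first fixes the common divisor [h] of the forms of [x], then frees its
   linear factors one after the other. *)
Lemma chain_lengths_common_factor x h a b : (size h <= l.+1)%N ->
  coprime_forms m.+1 a b -> form x q0 = h * a -> form x q1 = h * b ->
  chain_lengths (common_factor 1 l m.+1) x (l + (m + m)).
Proof.
move=> sh cab xa xb.
have h0 : h != 0.
  by apply: contraNneq (chart_form_neq0 pq x q0) => h0; rewrite xa h0 mul0r.
have [sa sb] : (size a <= m.+2)%N /\ (size b <= m.+2)%N by case: cab => _; lia.
have [c [z [c0 zE hE]]] := factor_form h0 sh.
have sz i : (size (z i) <= 2)%N.
  by case: (zE i) => [->|[r ->]]; rewrite ?size_poly1 ?size_XsubC.
(* [e j] is the part of [h] still imposed at stage [j], and [g j] the part already set free. *)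
pose e j := \prod_(j <= i < l) z i.
have eS j : (j < l)%N -> e j = z j * e j.+1 by move=> jl; rewrite /e big_ltn.
have el : e l = 1 by rewrite /e big_geq.
pose g j := c *: \prod_(0 <= i < j) z i.
have hE' j : (j <= l)%N -> h = e j * g j.
  by move=> jl; rewrite hE /e /g -(big_mkord xpredT z) (@big_cat_nat _ _ _ j) //= -scalerAr mulrC.
have sg j : (size (g j) <= j.+1)%N.
  by apply: leq_trans (size_scale_leq _ _) _; rewrite big_mkord; apply: size_prod_linear.
have se k : (k <= l)%N -> (size (e (l - k)%N) <= k.+1)%N.
  elim: k => [|k IH] kl; first by rewrite subn0 el size_poly1.
  rewrite eS; last by lia.
  have -> : (l - k.+1).+1 = (l - k)%N by lia.
  have := @size_mul_le _ (z (l - k.+1)%N) (e (l - k)%N) 1 k (sz _); rewrite add1n; apply.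
  by apply: IH; apply: ltnW.
have {}se j : (j <= l)%N -> (size (e j) <= (l - j).+1)%N.
  by move=> jl; have := se (l - j)%N (leq_subr _ _); rewrite subKn.
pose Y j := common_factor (e j) j m.+1.
have Yx j : (j <= l)%N -> Y j x.
  by move=> jl; exists (g j), a, b; rewrite -hE'.
have YS j : (j < l)%N -> Y j `<=` Y j.+1.
  by move=> jl; rewrite /Y eS //; apply: common_factorS.
have YX j : (j <= l)%N -> Y j `<=` common_factor 1 l m.+1.
  rewrite -el -/(Y l) => jl; rewrite -(subKn jl); move: (l - j)%N (leq_subr j l) => k.
  elim: k => [|k IH] kl; first by rewrite subn0.
  have lt : (l - k.+1 < l)%N by lia.
  move=> y /(YS _ lt); rewrite (_ : (l - k.+1).+1 = (l - k)%N); last by lia.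
  by apply: IH; apply: ltnW.
have Yprime j : (j <= l)%N -> prime_set (Y j).
  move=> jl; apply: common_factor_prime; first by exists x; apply: Yx.
  move=> h' a' sh' sa'; rewrite (_ : d = (l - j + j + m.+1)%N); last by rewrite dlm; lia.
  by apply: size_mul_le => //; apply: size_mul_le => //; apply: se.
have Ysep j : (j < l)%N ->
    exists2 f, vanishing_ideal (Y j) f & ~ vanishing_ideal (Y j.+1) f.
  move=> jl; rewrite /Y eS //.
  apply: (@common_factor_separation x (e j.+1) (z j) (g j) a b (l - j.+1)) => //.
  - by rewrite dlm; lia.
  - exact: se.
  - by rewrite xa {1}(hE' j (ltnW jl)) eS.
  - by rewrite xb {1}(hE' j (ltnW jl)) eS.
have [r [M [fM mr MT]]] := divisible_tangents h0 sh.
have AY i : affine_flag x M i `<=` Y 0%N.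
  move=> y [v _ ->]; have [u su Eu] := MT v q0; have [u' su' Eu'] := MT v q1.
  have sD (f1 f2 : {poly F}) : (size f1 <= m.+2)%N -> (size f2 <= m.+2)%N ->
      (size (f1 + f2)%R <= m.+2)%N.
    by move=> s1 s2; apply: leq_trans (size_polyD _ _) _; rewrite geq_max s1.
  exists (g 0%N), (a + u), (b + u').
  rewrite -hE' // -[v *m M]scale1r !chart_form_line !scale1r Eu Eu' xa xb !mulrDr.
  by split=> //; apply: sD.
(* [Y 0] itself is skipped: the last affine set lies in it, so the function that separates [Y 0]
   from [Y 1] also serves at the junction. *)
pose Z i := if (i <= m + m)%N then affine_flag x M i else Y (i - (m + m))%N.
apply: (@flag_chain _ _ _ _ Z); first exact: affine_flag_base.
  move=> i ir; rewrite /Z; case: leqP => im.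
    by split; [move=> y /AY; apply: YX | apply: affine_flag_prime].
  by split; [apply: YX | apply: Yprime]; lia.
move=> i ir; rewrite /Z; case: (ltnP i (m + m)) => im.
  rewrite ltnW //; split; first exact: affine_flag_sub.
  by apply: affine_flag_separation => //; apply: leq_trans mr.
have [ZY ->] : (if (i <= m + m)%N then affine_flag x M i else Y (i - (m + m))%N) `<=`
    Y (i - (m + m))%N /\ (i.+1 - (m + m) = (i - (m + m)).+1)%N.
  split; last by rewrite subSn.
  case: leqP => im'; last by move=> y.
  by have -> : (i - (m + m) = 0)%N by lia.
have il : (i - (m + m) < l)%N by lia.
split; first by move=> y /ZY; apply: YS.
by have [f fY fY'] := Ysep _ il; exists f => // y /ZY; apply: fY.
Qed.

End LowerBound.

(** * Orders of vanishing on the curve and the degree of the divisor *)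

Section BinaryFormOrder.
Variable F : closedFieldType.
Implicit Types (c f g s t : {poly F}) (r : F) (n k : nat).

Definition binary_form n c s t : {poly F} := \sum_(i < n.+1) c`_i *: (s ^+ (n - i) * t ^+ i).

Lemma binary_form_infinity n c s t : (size c <= n.+1)%N ->
  binary_form n.+1 c s t = s * binary_form n c s t.
Proof.
move=> sc; rewrite /binary_form big_ord_recr /= nth_default // scale0r addr0 mulr_sumr.
apply: eq_bigr => i _; rewrite subSn -1?ltnS // exprS -scalerAr; congr (_ *: _); ring.
Qed.

Lemma binary_form_XsubC n c s t r : (size c <= n.+1)%N ->
  binary_form n.+1 (c * ('X - r%:P)) s t = (t - r *: s) * binary_form n c s t.
Proof.
move=> sc; rewrite mulrBl -scalerAl -binary_form_infinity //.
have -> : t * binary_form n c s t = \sum_(i < n.+2) (c * 'X)`_i *: (s ^+ (n.+1 - i) * t ^+ i).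
  rewrite big_ord_recl coefMX scale0r add0r mulr_sumr; apply: eq_bigr => i _.
  rewrite lift0 coefMX /= subSS exprS -scalerAr; congr (_ *: _); ring.
rewrite /binary_form scaler_sumr -sumrB; apply: eq_bigr => i _.
by rewrite mulrBr coefB coefMC scalerBl scalerA [r * _]mulrC.
Qed.

Lemma binary_form_XsubCX n k c s t r : (size c <= n.+1)%N ->
  binary_form (n + k) (c * ('X - r%:P) ^+ k) s t = (t - r *: s) ^+ k * binary_form n c s t.
Proof.
move=> sc; elim: k => [|k IH]; first by rewrite addn0 !expr0 mulr1 mul1r.
rewrite addnS !exprSr mulrA binary_form_XsubC ?IH; first by ring.
apply: size_mul_le => //; elim: {IH} k => [|k IH]; first by rewrite expr0 size_poly1.
by rewrite size_exp_XsubC.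
Qed.

Lemma binary_form_infinityX n k c s t : (size c <= n.+1)%N ->
  binary_form (n + k) c s t = s ^+ k * binary_form n c s t.
Proof.
move=> sc; elim: k => [|k IH]; first by rewrite addn0 mul1r.
by rewrite addnS exprS binary_form_infinity ?IH ?mulrA // (leq_trans sc) // ltnS leq_addr.
Qed.

Lemma horner_binary_form n c s t x : (size c <= n.+1)%N -> s.[x] != 0 ->
  (binary_form n c s t).[x] = s.[x] ^+ n * c.[t.[x] / s.[x]].
Proof.
move=> sc s0; rewrite [c in RHS](poly_sum_coef sc) /binary_form !horner_sum mulr_sumr.
apply: eq_bigr => i _; rewrite !hornerZ hornerM !horner_exp hornerX expr_div_n.
have -> : s.[x] ^+ n = s.[x] ^+ (n - i) * s.[x] ^+ i.
  by rewrite -exprD subnK // -ltnS.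
by field; rewrite expf_neq0.
Qed.

Lemma horner_binary_form_infinity n c s t x : s.[x] = 0 ->
  (binary_form n c s t).[x] = c`_n * t.[x] ^+ n.
Proof.
move=> s0; rewrite /binary_form horner_sum big_ord_recr big1 /= ?add0r.
  by rewrite hornerZ hornerM !horner_exp subnn expr0 mul1r.
by move=> i _; rewrite hornerZ hornerM !horner_exp s0 expr0n subn_eq0 leqNgt ltn_ord mul0r mulr0.
Qed.

(* The order at [u] of a form of degree [n]; it vanishes at infinity
   to the order of its degree defect. *)
Definition form_order n (u : 'rV[F]_2) c : nat :=
  if u ord0 ord0 == 0 then (n.+1 - size c)%N else mup (u ord0 ord_max / u ord0 ord0) c.

Lemma mup_monomial (x : F) k f : x != 0 -> f.[0] != 0 -> mup 0 ((x *: 'X) ^+ k * f) = k.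
Proof.
move=> x0 f0; rewrite mupMl // exprZn -mul_polyC mulrC mupMl; last first.
  by rewrite rootC expf_neq0.
by have := mup_XsubCX k (0 : F) 0; rewrite eqxx subr0.
Qed.

(** In the local parameter the linear form vanishing at [u], which is [t - r s] at a finite point
    and [s] at infinity, becomes a nonzero multiple of ['X]; the remaining factor is nonzero at
    0. *)
Lemma mup_binary_form n c (u w : 'rV[F]_2) : c != 0 -> (size c <= n.+1)%N ->
  u ord0 ord0 * w ord0 ord_max - u ord0 ord_max * w ord0 ord0 != 0 ->
  mup 0 (binary_form n c ((u ord0 ord0)%:P + w ord0 ord0 *: 'X)
                         ((u ord0 ord_max)%:P + w ord0 ord_max *: 'X)) = form_order n u c.
Proof.
set u0 := u ord0 ord0; set u1 := u ord0 ord_max.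
set w0 := w ord0 ord0; set w1 := w ord0 ord_max => c0 sc det0; rewrite /form_order -/u0 -/u1.
case: (eqVneq u0 0) => [u00|u00].
  move: det0; rewrite u00 mul0r sub0r oppr_eq0 mulf_eq0 negb_or => /andP[u10 w00].
  have sc' : (size c <= (size c).-1.+1)%N by rewrite leqSpred.
  have -> : n = ((size c).-1 + (n.+1 - size c))%N.
    by move: sc; rewrite -size_poly_gt0 in c0; lia.
  rewrite binary_form_infinityX // polyC0 add0r mup_monomial //.
    by move: sc; rewrite -size_poly_gt0 in c0; lia.
  rewrite horner_binary_form_infinity; last by rewrite hornerZ hornerX mulr0.
  rewrite hornerD hornerC hornerZ hornerX mulr0 addr0 mulf_neq0 ?expf_neq0 //.
  by rewrite -[_`_ _]/(lead_coef c) lead_coef_eq0.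
have [k [c' /implyP/(_ c0) c'r ce]] := multiplicity_XsubC c (u1 / u0).
have c'0 : c' != 0 by apply: contraNneq c0 => z; rewrite ce z mul0r.
have sce : size c = (size c' + k)%N.
  by rewrite ce size_Mmonic ?monic_exp ?monicXsubC // size_exp_XsubC addnS.
have -> : n = (n - k + k)%N.
  by move: c'0 sc; rewrite sce -size_poly_gt0; lia.
have sc' : (size c' <= (n - k).+1)%N by move: sc; rewrite sce; lia.
rewrite ce mupMr // mup_XsubCX eqxx binary_form_XsubCX //.
have -> : u1%:P + w1 *: 'X - (u1 / u0) *: (u0%:P + w0 *: 'X) = (w1 - u1 / u0 * w0) *: 'X.
  rewrite scalerDr -!mul_polyC -polyCM divfK // mulrA -polyCM rmorphB /=; ring.
rewrite mup_monomial //.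
  apply: contraNneq det0 => e.
  by rewrite -[u1](divfK u00) mulrAC [_ * u0]mulrC -mulrBr e mulr0.
rewrite horner_binary_form // !hornerE ?mulr0 ?addr0 //.
by rewrite mulf_neq0 ?expf_neq0.
Qed.

End BinaryFormOrder.

Section NormalCurvePoints.
Variables (F : closedFieldType) (d : nat).
Hypothesis d0 : (0 < d)%N.
Implicit Types (u w : 'rV[F]_2).

Lemma row2_eq u w : u ord0 ord0 = w ord0 ord0 -> u ord0 ord_max = w ord0 ord_max -> u = w.
Proof.
move=> e0 e1; apply/rowP; case=> [[|[|]]] //= H.
  by move: e0; congr (u _ _ = w _ _); apply: val_inj.
by move: e1; congr (u _ _ = w _ _); apply: val_inj.
Qed.

Lemma row2_neq0 u : u != 0 -> u ord0 ord0 = 0 -> u ord0 ord_max != 0.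
Proof.
move=> u0 u00; apply: contraNneq u0 => u01; apply/eqP/rowP => i; rewrite mxE.
have := ltn_ord i; case: i => [[|[|]]] //= H _.
- by rewrite -[RHS]u00; congr (u _ _); apply: val_inj.
- by rewrite -[RHS]u01; congr (u _ _); apply: val_inj.
Qed.

Lemma rnc_point_scale u k : k != 0 -> rnc_point d (k *: u) = rnc_point d u.
Proof.
move=> k0; rewrite /rnc_point.
have -> : veronese d ((k *: u) ord0 ord0) ((k *: u) ord0 ord_max) =
    k ^+ d *: veronese d (u ord0 ord0) (u ord0 ord_max).
  apply/rowP => i; rewrite !mxE !exprMn.
  have -> : k ^+ d = k ^+ (d - i) * k ^+ i by rewrite -exprD subnK // -ltnS.
  by ring.
apply/vspaceP => v; apply/vlineP/vlineP => -[c ->].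
  by exists (c * k ^+ d); rewrite scalerA.
by exists (c / k ^+ d); rewrite scalerA divfK // expf_neq0.
Qed.

(** The ratio is read off the entries 0 and 1 of the Veronese vector; at infinity both quotients are
    0, by the convention for the inverse of 0. *)
Lemma rnc_point_eq u u' : u != 0 -> rnc_point d u = rnc_point d u' ->
  (u ord0 ord0 == 0) = (u' ord0 ord0 == 0) /\
  u ord0 ord_max / u ord0 ord0 = u' ord0 ord_max / u' ord0 ord0.
Proof.
move=> u_neq0 e; have : veronese d (u ord0 ord0) (u ord0 ord_max) \in rnc_point d u'.
  by rewrite -e memv_line.
case/vlineP => k /rowP E.
have := E ord0; rewrite !mxE subn0 !expr0 !mulr1 => E0.
have := E ord_max; rewrite !mxE /= subnn !expr0 !mul1r => Ed.
have d1 : (1 < d.+1)%N by [].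
have := E (Ordinal d1); rewrite !mxE /= !expr1 => E1.
have [u00|u00] := eqVneq (u ord0 ord0) 0.
  have k0 : k != 0.
    apply: contraNneq (row2_neq0 u_neq0 u00) => k0; move: Ed; rewrite k0 mul0r => /eqP.
    by rewrite expf_eq0 => /andP[].
  move: E0; rewrite u00 expr0n gtn_eqF // => /esym/eqP.
  by rewrite mulf_eq0 (negPf k0) expf_eq0 d0 /= => /eqP ->; rewrite eqxx !invr0 !mulr0.
have k0 : k != 0.
  apply: contraNneq u00 => k0; move: E0; rewrite k0 mul0r => /eqP.
  by rewrite expf_eq0 => /andP[].
have u'00 : u' ord0 ord0 != 0.
  apply: contraNneq u00 => z; move: E0; rewrite z expr0n gtn_eqF // mulr0 => /eqP.
  by rewrite expf_eq0 => /andP[].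
rewrite (negPf u'00); split=> //.
have dE (x : F) : x ^+ d = x ^+ (d - 1) * x by rewrite -exprSr subn1 prednK.
apply: (mulfI (expf_neq0 d u00)); rewrite {1}dE E0 dE.
transitivity (u ord0 ord0 ^+ (d - 1) * u ord0 ord_max); first by field.
by rewrite E1; field.
Qed.

Lemma free_det u w : free [:: u; w] -> u != 0 /\
  u ord0 ord0 * w ord0 ord_max - u ord0 ord_max * w ord0 ord0 != 0.
Proof.
move=> fr; have : u \notin <[w]>%VS by move: fr; rewrite free_cons span_seq1 => /andP[].
move=> uw; split; first by apply: contraNneq uw => ->; exact: mem0v.
apply: contra uw; rewrite subr_eq0 => /eqP e.
have w0 : w != 0 by move: fr; rewrite free_cons seq1_free => /andP[].
apply/vlineP; have [w00|w00] := eqVneq (w ord0 ord0) 0.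
  have w01 := row2_neq0 w0 w00; exists (u ord0 ord_max / w ord0 ord_max).
  apply: row2_eq; rewrite mxE; last by rewrite divfK.
  by rewrite w00 mulr0; move: e; rewrite w00 mulr0 => /eqP; rewrite mulf_eq0 (negPf w01) orbF => /eqP.
exists (u ord0 ord0 / w ord0 ord0); apply: row2_eq; rewrite mxE; first by rewrite divfK.
by rewrite mulrAC e mulfK.
Qed.

Definition form_of (phi : linear_form F d) : {poly F} :=
  \sum_(i < d.+1) phi (delta_mx ord0 i) *: 'X^i.

Lemma coef_form_of phi (i : 'I_d.+1) : (form_of phi)`_i = phi (delta_mx ord0 i).
Proof.
rewrite coef_sum (bigD1 i) //= coefZ coefXn eqxx mulr1 big1 ?addr0 // => j ji.
by rewrite coefZ coefXn eq_sym (inj_eq val_inj) (negPf ji) mulr0.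
Qed.

Lemma size_form_of phi : (size (form_of phi) <= d.+1)%N.
Proof.
apply: leq_trans (size_sum _ _ _) _; apply/bigmax_leqP => i _.
by apply: leq_trans (size_scale_leq _ _) _; rewrite size_polyXn.
Qed.

Lemma form_of_eq0 phi : (form_of phi == 0) = (phi == 0).
Proof.
apply/eqP/eqP => [e|->]; last by apply: big1 => i _; rewrite lfunE /= scale0r.
apply/lfunP => v; rewrite [v]row_sum_delta linear_sum lfunE /=; apply: big1 => i _.
by rewrite linearZ /= -coef_form_of e coef0 scaler0.
Qed.

Lemma form_of_surj (f : {poly F}) : (size f <= d.+1)%N -> exists phi, form_of phi = f.
Proof.
move=> sf; pose L (v : 'rV[F]_d.+1) : F^o := \sum_i v ord0 i * f`_i.
have linL : linear L.
  move=> c u v; rewrite /L scaler_sumr -big_split; apply: eq_bigr => i _.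
  by rewrite !mxE mulrDl [c *: _]mulrA.
pose L' : {linear 'rV[F]_d.+1 -> F^o} :=
  HB.pack L (GRing.isLinear.Build F 'rV[F]_d.+1 F^o _ L linL).
exists (linfun L'); rewrite [RHS](poly_sum_coef sf) /form_of; apply: eq_bigr => i _.
congr (_ *: _); rewrite lfunE /= /L (bigD1 i) //= mxE !eqxx mul1r big1 ?addr0 // => j ji.
by rewrite mxE eqxx (negPf ji) mul0r.
Qed.

Lemma vanishing_orderE phi (u : 'rV[F]_2) m : u != 0 -> phi != 0 ->
  vanishing_order phi (rnc_point d u) m <-> m = form_order d u (form_of phi).
Proof.
move=> u0 phi0; have c0 : form_of phi != 0 by rewrite form_of_eq0.
have lE (v w : 'rV[F]_2) : free [:: v; w] ->
    mup 0 (local_equation phi v w) = form_order d v (form_of phi).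
  move=> /free_det[v0 dt]; rewrite -(mup_binary_form c0 (size_form_of phi) dt); congr mup.
  by apply: eq_bigr => i _; rewrite mxE coef_form_of.
split=> [[v [w [fr e ->]]]|->].
  by rewrite lE // /form_order; have [-> ->] := rnc_point_eq u0 e.
pose w : 'rV[F]_2 := delta_mx ord0 (if u ord0 ord0 == 0 then ord0 else ord_max).
have fr : free [:: u; w].
  rewrite free_cons span_seq1 seq1_free; apply/andP; split; last first.
    apply/eqP => /rowP/(_ (if u ord0 ord0 == 0 then ord0 else ord_max)).
    by rewrite !mxE !eqxx => /eqP; rewrite oner_eq0.
  apply/negP => /vlineP[k /rowP E]; have [u00|u00] := eqVneq (u ord0 ord0) 0.
    by move: (E ord_max) (row2_neq0 u0 u00); rewrite !mxE u00 !eqxx /= mulr0 => ->; rewrite eqxx.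
  by move: (E ord0); rewrite !mxE (negPf u00) /= mulr0 => e; rewrite e eqxx in u00.
by exists u, w; rewrite lE.
Qed.

End NormalCurvePoints.

Section MultiplicitySum.
Variable F : closedFieldType.
Implicit Types (f g : {poly F}) (rs : seq F).

Lemma mup_gcdp r f g : f != 0 -> g != 0 -> mup r (gcdp f g) = minn (mup r f) (mup r g).
Proof.
move=> f0 g0; have h0 : gcdp f g != 0 by rewrite gcdp_eq0 negb_and f0.
have H n : (n <= mup r (gcdp f g))%N = (n <= minn (mup r f) (mup r g))%N.
  by rewrite leq_min !mup_geq // dvdp_gcd.
by apply/eqP; rewrite eqn_leq H leqnn -H leqnn.
Qed.

Lemma mup_prod_XsubC r rs : mup r (\prod_(z <- rs) ('X - z%:P)) = count_mem r rs.
Proof.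
elim: rs => [|z rs IH]; first by rewrite big_nil mupNroot // root1.
rewrite big_cons mupM ?polyXsubC_eq0 ?monic_neq0 ?monic_prod_XsubC // IH /=; congr (_ + _)%N.
by rewrite -['X - _]expr1 mup_XsubCX eq_sym; case: eqP.
Qed.

Lemma sum_count_undup (T : eqType) (s : seq T) : (\sum_(x <- undup s) count_mem x s)%N = size s.
Proof.
under eq_bigr => x _ do rewrite -sum1_count big_mkcond.
rewrite exchange_big /= -[RHS]sum1_size; apply: eq_big_seq => y ys.
rewrite -big_mkcond sum1_count /=; transitivity (count_mem y (undup s)).
  by apply: eq_count => x; rewrite /= eq_sym.
by rewrite count_uniq_mem ?undup_uniq // mem_undup ys.
Qed.

End MultiplicitySum.

Section DivisorDegree.
Variables (F : closedFieldType) (d : nat).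
Variables (p : 'I_d.-1 -> 'I_d.+1) (q : 'I_(d.+1 - d.-1) -> 'I_d.+1).
Hypothesis hd : (2 <= d)%N.
Hypothesis pq : chart_index p q.
Notation q0 := (q0 hd).
Notation q1 := (q1 hd).
Notation form := (chart_form p q).
Notation N := (d.-1 * (d.+1 - d.-1))%N.
Implicit Types (f g : {poly F}) (y : 'rV[F]_N).

Let d0 : (0 < d)%N. Proof. exact: ltnW. Qed.

Lemma sum_q (V : nmodType) (G : 'I_(d.+1 - d.-1) -> V) : \sum_j G j = G q0 + G q1.
Proof.
rewrite (bigD1 q0) //= (bigD1 q1) //= big1 ?addr0 // => j /andP[j0 j1].
by have [e|e] := q01 hd j; move: j0 j1; rewrite e eqxx.
Qed.

(** Identifies the linear forms that vanish on the subspace with the pencil of the two chart forms,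
    the columns [q] giving the coefficients. *)
Lemma chart_sub_lker y (phi : linear_form F d) :
  (chart p q y <= lker phi)%VS <->
  form_of phi = (form_of phi)`_(q q0) *: form y q0 + (form_of phi)`_(q q1) *: form y q1.
Proof.
have phiE i : phi (delta_mx ord0 (p i) + \sum_(j < d.+1 - d.-1) vec_mx y i j *: delta_mx ord0 (q j)) =
    (form_of phi)`_(p i) + (vec_mx y i q0 * (form_of phi)`_(q q0) + vec_mx y i q1 * (form_of phi)`_(q q1)).
  by rewrite linearD linear_sum sum_q !linearZ /= !coef_form_of.
have sphi := size_form_of phi.
split.
  move/subv_sumP => H; apply: (@chart_poly_eq _ _ _ hd pq F) => //.
  - apply: leq_trans (size_polyD _ _) _.
    by rewrite geq_max !(leq_trans (size_scale_leq _ _)) ?size_form.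
  - move=> i; have := H i isT; rewrite -memvE memv_ker phiE.
    rewrite coefD !coefZ !(coef_form_p pq) => /eqP E.
    by apply/eqP; rewrite -subr_eq0 -[X in _ == X]E; apply/eqP; ring.
  - by rewrite coefD !coefZ !(coef_form_q pq) eqxx q10 /=; ring.
  - by rewrite coefD !coefZ !(coef_form_q pq) eqxx [q0 == _]eq_sym q10 /=; ring.
move=> E; apply/subv_sumP => i _; rewrite -memvE memv_ker phiE.
rewrite {1}E coefD !coefZ !(coef_form_p pq); apply/eqP; ring.
Qed.

Lemma chart_form_functional y j : exists phi : linear_form F d,
  [/\ form_of phi = form y j, phi != 0 & (chart p q y <= lker phi)%VS].
Proof.
have [phi e] := form_of_surj (size_form p q y j); exists phi; split=> //.
  by rewrite -form_of_eq0 e (chart_form_neq0 pq).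
apply/chart_sub_lker; rewrite e !(coef_form_q pq).
by have [->|->] := q01 hd j; rewrite ?eqxx ?q10 ?[q0 == _]eq_sym ?q10 scale1r scale0r ?addr0 ?add0r.
Qed.

(** One of the two generators of the pencil attains the minimum, and a combination of them cannot
    vanish to lower order. *)
Lemma divisor_multE y (u : 'rV[F]_2) : u != 0 ->
  divisor_mult (chart p q y) (rnc_point d u) =
  if u ord0 ord0 == 0 then (d.+1 - maxn (size (form y q0)) (size (form y q1)))%N
  else mup (u ord0 ord_max / u ord0 ord0) (gcdp (form y q0) (form y q1)).
Proof.
move=> u_neq0; set f := form y q0; set g := form y q1.
have f0 : f != 0 := chart_form_neq0 pq y q0; have g0 : g != 0 := chart_form_neq0 pq y q1.
have h0 : gcdp f g != 0 by rewrite gcdp_eq0 negb_and f0.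
apply: nat_infimumE.
  suff [j ->] : exists j, (if u ord0 ord0 == 0 then (d.+1 - maxn (size f) (size g))%N
      else mup (u ord0 ord_max / u ord0 ord0) (gcdp f g)) = form_order d u (form y j).
    have [phi [e phi0 sub]] := chart_form_functional y j; exists phi; split=> //.
    by apply/vanishing_orderE => //; rewrite e.
  rewrite /form_order; case: eqP => _.
    by case: (leqP (size f) (size g)) => _; [exists q1 | exists q0].
  rewrite mup_gcdp //; set r := _ / _.
  by case: (leqP (mup r f) (mup r g)) => _; [exists q0 | exists q1].
move=> k [phi [phi0 /chart_sub_lker E /(vanishing_orderE d0 _ u_neq0 phi0) ->]].
have c0 : form_of phi != 0 by rewrite form_of_eq0.
rewrite /form_order; case: eqP => _.
  apply: leq_sub2l; rewrite E; apply: leq_trans (size_polyD _ _) _.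
  rewrite geq_max; apply/andP; split; apply: leq_trans (size_scale_leq _ _) _;
    by rewrite leq_max leqnn ?orbT.
rewrite mup_geq // E; set r := _ / _.
have /andP[df dg] : (('X - r%:P) ^+ mup r (gcdp f g) %| f) && (('X - r%:P) ^+ mup r (gcdp f g) %| g).
  by rewrite -dvdp_gcd -mup_geq.
by rewrite -!mul_polyC dvdp_add // dvdp_mull.
Qed.

Definition row2 (a b : F) : 'rV[F]_2 := \row_i (if i == ord0 then a else b).

(** The finite points contribute the roots of the gcd with multiplicity; the point at infinity
    contributes the common defect of degree. *)
Lemma divisor_degreeE y : divisor_degree (chart p q y) =
  ((size (gcdp (form y q0) (form y q1))).-1 +
   (d.+1 - maxn (size (form y q0)) (size (form y q1))))%N.
Proof.
set f := form y q0; set g := form y q1; set h := gcdp f g.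
have f0 : f != 0 := chart_form_neq0 pq y q0.
have h0 : h != 0 by rewrite gcdp_eq0 negb_and f0.
have [rs hE] := closed_field_poly_normal h.
pose pt r := rnc_point d (row2 1 r); pose oo := rnc_point d (row2 0 1).
have r1 r : row2 1 r != 0.
  by apply/eqP => /rowP/(_ ord0); rewrite !mxE eqxx => /eqP; rewrite oner_eq0.
have roo : row2 0 1 != 0.
  by apply/eqP => /rowP/(_ ord_max); rewrite !mxE /= => /eqP; rewrite oner_eq0.
have m1 r : divisor_mult (chart p q y) (pt r) = count_mem r rs.
  rewrite divisor_multE // !mxE eqxx oner_eq0 /= divr1 -/h hE -mul_polyC mupMr ?mup_prod_XsubC //.
  by rewrite rootC lead_coef_eq0.
have moo : divisor_mult (chart p q y) oo = (d.+1 - maxn (size f) (size g))%N.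
  by rewrite divisor_multE // !mxE !eqxx.
have ptinj : injective pt.
  by move=> r r' /(rnc_point_eq d0 (r1 r))[_]; rewrite !mxE /= !divr1 => e.
have ptoo r : pt r != oo.
  apply/eqP => /(rnc_point_eq d0 (r1 r))[+ _]; rewrite !mxE !eqxx oner_eq0.
  by [].
pose L := oo :: map pt (undup rs).
have Lu : uniq L.
  rewrite /= map_inj_uniq ?undup_uniq // andbT; apply/mapP => -[r _ e].
  by move: (ptoo r); rewrite -e eqxx.
rewrite /divisor_degree -(@fsbig_widen _ _ _ _ [set` L]); last 2 first.
- move=> P /=; rewrite inE => /orP[/eqP ->|/mapP[r _ ->]].
    by exists (row2 0 1) => //=; exact: roo.
  by exists (row2 1 r) => //=; exact: r1.
- move=> P /= [[u u0 <-]] PL; have [u00|u00] := eqVneq (u ord0 ord0) 0.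
    case: PL; rewrite inE; apply/orP; left; apply/eqP.
    rewrite -[RHS](rnc_point_scale d (row2 0 1) (row2_neq0 u0 u00)); congr rnc_point; apply: row2_eq.
      by rewrite !mxE mulr0.
    by rewrite !mxE mulr1.
  have uE : rnc_point d u = pt (u ord0 ord_max / u ord0 ord0).
    rewrite -[RHS](rnc_point_scale d (row2 1 _) u00); congr rnc_point; apply: row2_eq; rewrite !mxE.
      by rewrite mulr1.
    by rewrite /= mulrC divfK.
  rewrite /= uE m1; apply/count_memPn; apply/negP => rrs; apply: PL.
  by rewrite uE inE map_f ?orbT // mem_undup.
rewrite -fsbig_seq // big_cons big_map moo addnC; congr (_ + _)%N.
under eq_bigr => r _ do rewrite m1.
rewrite sum_count_undup {1}hE size_scale ?lead_coef_eq0 //.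
by rewrite size_prod_XsubC.
Qed.

End DivisorDegree.

(** * The charts cover the Grassmannian *)

Section Charts.
Variables (F : closedFieldType) (k n : nat).

Lemma chart_rowspace (p : 'I_k -> 'I_n) (q : 'I_(n - k) -> 'I_n) (y : 'rV[F]_(k * (n - k))) v :
  v \in chart p q y <->
  (v <= \matrix_i (delta_mx ord0 (p i) + \sum_(j < n - k) vec_mx y i j *: delta_mx ord0 (q j)))%MS.
Proof.
pose r i : 'rV[F]_n := delta_mx ord0 (p i) + \sum_(j < n - k) vec_mx y i j *: delta_mx ord0 (q j).
set M := \matrix_i r i.
have rM i : row i M = r i by rewrite rowK.
split.
  case/memv_sumP => vs Hvs ->; apply: summx_sub => i _.
  by have /vlineP[c ->] := Hvs i isT; rewrite -/(r i) -rM scalemx_sub // row_sub.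
case/submxP => c ->; rewrite mulmx_sum_row; apply: memv_suml => i _.
rewrite rM; apply: (subvP (sumv_sup i _ (subvv _))) => //.
by rewrite memvZ // memv_line.
Qed.

Lemma dim_chart (p : 'I_k -> 'I_n) (q : 'I_(n - k) -> 'I_n) (y : 'rV[F]_(k * (n - k))) :
  chart_index p q -> \dim (chart p q y) = k.
Proof.
move=> /bij_inj inj; rewrite (dim_vspace_rowspace (chart_rowspace p q y)).
set M := \matrix_i _; apply/eqP; change (row_free M); apply/row_freeP.
exists (\matrix_(a, i) (a == p i)%:R); apply/matrixP => i i'; rewrite !mxE.
rewrite (bigD1 (p i')) //= big1 => [|a ap]; last by rewrite !mxE (negPf ap) mulr0.
rewrite !mxE eqxx mulr1 addr0 summxE big1 ?addr0 => [|j _].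
  rewrite eqxx /=; congr (_%:R); congr nat_of_bool.
  by apply/eqP/eqP => [e|->//]; have [->] : inl i' = inl i :> 'I_k + 'I_(n - k) by apply: inj.
rewrite !mxE eqxx /=; case: eqP => [e|_]; last by rewrite mulr0.
by have : inl i' = inr j :> 'I_k + 'I_(n - k) by apply: inj.
Qed.

(** Gaussian elimination: [p] picks columns where a basis matrix of [V] has an invertible minor, and
    multiplication by the inverse gives the coordinates. *)
Lemma chart_cover (V : {vspace 'rV[F]_n}) : \dim V = k ->
  exists (p : 'I_k -> 'I_n) (q : 'I_(n - k) -> 'I_n) y, chart_index p q /\ chart p q y = V.
Proof.
move=> dV; pose b : k.-tuple 'rV[F]_n := tcast dV (vbasis V).
have bV : basis_of V b by rewrite /b val_tcast; apply: vbasisP.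
pose M : 'M[F]_(k, n) := \matrix_i tnth b i.
have Mfree : row_free M.
  rewrite -kermx_eq0; apply/rowV0P => u /sub_kermxP; rewrite mulmx_sum_row => e.
  apply/rowP => i; rewrite mxE; move: (basis_free bV) => /freeP/(_ (fun i => u ord0 i)).
  apply; rewrite -[RHS]e; apply: eq_bigr => j _; by rewrite rowK (tnth_nth 0).
have full : row_full M^T by rewrite /row_full mxrank_tr.
pose p i := fullrankfun full i.
have p_inj : injective p by move=> i j; apply: fullrankfun_inj.
have pU : (colsub p M) \in unitmx.
  rewrite -unitmx_tr; have -> : (colsub p M)^T = rowsub (fullrankfun full) M^T.
    by apply/matrixP => i j; rewrite !mxE.
  exact: fullrowsub_unit.
pose A : {set 'I_n} := ~: [set p i | i : 'I_k].
have cA : #|A| = (n - k)%N by rewrite cardsCs finset.setCK card_imset // !card_ord.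
pose q (j : 'I_(n - k)) : 'I_n := enum_val (cast_ord (esym cA) j).
have pq : chart_index p q.
  have kn : (k <= n)%N by rewrite -dV (leq_trans (dimvS (subvf V))) // dimvf /dim /= mul1n.
  apply: inj_card_bij; last by rewrite card_sum !card_ord subnKC.
  have pNq i j : p i <> q j.
    move=> e; have := enum_valP (cast_ord (esym cA) j); rewrite -/(q j) -e inE.
    by rewrite imset_f.
  move=> [i|j] [i'|j'] // e; first by rewrite (p_inj _ _ e).
  - by case: (pNq i j').
  - by case: (pNq i' j).
  - by have /cast_ord_inj -> := enum_val_inj e.
pose Y := invmx (colsub p M) *m M.
have Yp i i' : Y i (p i') = (i == i')%:R.
  have <- : (invmx (colsub p M) *m colsub p M) i i' = (i == i')%:R by rewrite mulVmx // mxE.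
  by rewrite !mxE; apply: eq_bigr => j _; rewrite !mxE.
exists p, q, (mxvec (\matrix_(i, j) Y i (q j))); split=> //.
apply/eqP; rewrite eqEdim dim_chart // dV leqnn andbT.
apply/subv_sumP => i _; rewrite -memvE.
have -> : delta_mx ord0 (p i) + \sum_(j < n - k)
    vec_mx (mxvec (\matrix_(i, j) Y i (q j))) i j *: delta_mx ord0 (q j) = row i Y.
  rewrite mxvecK [row i Y]row_sum_delta (reindex _ (onW_bij _ pq)) /= big_sumType /=; congr (_ + _).
    rewrite (bigD1 i) //= mxE Yp eqxx scale1r big1 ?addr0 // => i' ii'.
    by rewrite mxE Yp eq_sym (negPf ii') scale0r.
  by apply: eq_bigr => j _; rewrite !mxE.
rewrite row_mul mulmx_sum_row; apply: memv_suml => j _; rewrite rowK memvZ //.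
by apply: (basis_mem bV); apply: mem_tnth.
Qed.

End Charts.

(** * Secant loci in a chart and their singular points *)

Section SecantLocus.
Variables (F : closedFieldType) (d : nat).
Variables (p : 'I_d.-1 -> 'I_d.+1) (q : 'I_(d.+1 - d.-1) -> 'I_d.+1).
Hypothesis hd : (2 <= d)%N.
Hypothesis pq : chart_index p q.
Notation q0 := (q0 hd).
Notation q1 := (q1 hd).
Notation form := (chart_form p q).
Notation common_factor := (@common_factor d p q hd F).
Notation N := (d.-1 * (d.+1 - d.-1))%N.
Implicit Types (f g : {poly F}) (y : 'rV[F]_N).

Lemma divisor_subproduct f l : f != 0 -> (l < size f)%N ->
  exists2 h, h %| f & size h = l.+1.
Proof.
move=> f0 lf; have [rs fE] := closed_field_poly_normal f.
have rsl : (l <= size rs)%N.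
  by move: lf; rewrite {1}fE size_scale ?lead_coef_eq0 // size_prod_XsubC ltnS.
exists (\prod_(z <- take l rs) ('X - z%:P)); last by rewrite size_prod_XsubC size_takel.
rewrite fE -mul_polyC dvdp_mull // -[X in _ %| \prod_(z <- X) _](cat_take_drop l rs) big_cat.
exact: dvdp_mulr.
Qed.

Lemma Sec_chart l y : Sec F d l (chart p q y) <->
  exists2 m, d = (l + m)%N & common_factor 1 l m y.
Proof.
set f := form y q0; set g := form y q1.
have f0 : f != 0 := chart_form_neq0 pq y q0; have g0 : g != 0 := chart_form_neq0 pq y q1.
have sf : (size f <= d.+1)%N := size_form p q y q0.
have sg : (size g <= d.+1)%N := size_form p q y q1.
have h0 : gcdp f g != 0 by rewrite gcdp_eq0 negb_and f0.
have sh0 : (0 < size (gcdp f g))%N by rewrite size_poly_gt0.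
have shf : (size (gcdp f g) <= size f)%N := dvdp_leq f0 (dvdp_gcdl f g).
have sdiv (u h : {poly F}) : h != 0 -> h %| u -> exists2 a, u = 1 * h * a & (size a <= size u - (size h).-1)%N.
  move=> hn0 /dvdpP[a ->]; exists a; first by rewrite mul1r mulrC.
  have [->|a0] := eqVneq a 0; first by rewrite size_poly0.
  by rewrite size_mul //; move: hn0; rewrite -size_poly_gt0; move: (size a) (size h) => s1 s2; lia.
rewrite /Sec /Gr /= (divisor_degreeE hd pq) -/f -/g (dim_chart y pq).
split=> [[_ H]|[m dlm [h [a [b [sh sa sb fE gE]]]]]].
  (* If the gcd has degree below [l], all of it is taken; the missing degree is made up by zeros at
     infinity, that is by slack in the size of [h]. *)
  have [h hd' hs] : exists2 h, h %| gcdp f g & size h = (minn l (size (gcdp f g)).-1).+1.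
    apply: divisor_subproduct => //; move: (size (gcdp f g)) sh0 => s; lia.
  have hn0 : h != 0 by rewrite -size_poly_gt0 hs.
  have [a fa sa] := sdiv f h hn0 (dvdp_trans hd' (dvdp_gcdl f g)).
  have [b gb sb] := sdiv g h hn0 (dvdp_trans hd' (dvdp_gcdr f g)).
  move: (size (gcdp f g)) (size f) (size g) sf sg sh0 shf H hs sa sb => s1 s2 s3 sf' sg' sh0' shf' H hs sa sb.
  exists (d - l)%N; first by move: H; lia.
  exists h, a, b; split=> //; rewrite ?hs; first by lia.
    by apply: leq_trans sa _; rewrite hs; move: H; lia.
  by apply: leq_trans sb _; rewrite hs; move: H; lia.
split=> //; rewrite mul1r in fE gE.
have hn0 : h != 0 by apply: contraNneq f0 => z; rewrite /f fE z mul0r.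
have hG : (size h <= size (gcdp f g))%N.
  by apply: dvdp_leq => //; rewrite dvdp_gcd /f /g fE gE !dvdp_mulr.
have s1 : (size f <= size h + m)%N.
  rewrite /f fE; apply: leq_trans (size_polyMleq _ _) _.
  by move: (size h) (size a) sa => u1 u2; lia.
have s2 : (size g <= size h + m)%N.
  rewrite /g gE; apply: leq_trans (size_polyMleq _ _) _.
  by move: (size h) (size b) sb => u1 u2; lia.
move: hn0; rewrite -size_poly_gt0; move: (size (gcdp f g)) (size f) (size g) (size h) sf sg sh hG s1 s2.
move=> u1 u2 u3 u4; lia.
Qed.

(** Constant cofactors would make the two forms proportional, against a pivot equal to 1. *)
Lemma common_factor_pos l y : d = (l + 0)%N -> ~ common_factor 1 l 0 y.
Proof.
move=> dl [h [a [b [sh sa sb ya yb]]]]; have := pivot_form hd pq y.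
rewrite ya yb (size1_polyC sa) (size1_polyC sb) /chart_pivot !coefMC => e.
have : 1 = 0 :> F by rewrite -e; ring.
by move/eqP; rewrite oner_eq0.
Qed.

Lemma affine_singular_common_factor l m y : (0 < l)%N -> d = (l + m.+1)%N ->
  common_factor 1 l m.+1 y ->
  affine_singular (common_factor 1 l m.+1) y <-> common_factor 1 l.+1 m y.
Proof.
move=> l0 dlm yX.
have NE : (d.-1 * (d.+1 - d.-1) = l + m + (l + m))%N.
  have -> : (d.+1 - d.-1 = 2)%N by lia.
  by rewrite dlm addnS muln2 addnn.
have ub r : chain_lengths (common_factor 1 l m.+1) y r -> (r <= l + (m + m))%N.
  exact: chain_length_common_factor.
split=> [[_ sing]|yX'].
  have [h [a [b [sh sa sb]]]] := yX; rewrite mul1r => ya yb.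
  have [cab|ncab] := pselect (coprime_forms m.+1 a b).
    have locE : local_dim (common_factor 1 l m.+1) y = (l + (m + m))%N.
      apply: nat_supremumE ub; exact: (chain_lengths_common_factor pq dlm sh cab ya yb).
    case: sing; rewrite (dim_tangent_coprime pq dlm sh cab ya yb) locE; lia.
  have [z [a' [b' [sz sa' sb' ea eb]]]] := common_linear_factor sa sb ncab.
  exists (h * z), a', b'; split=> //.
  - by have := @size_mul_le _ h z l 1 sh sz; rewrite addn1.
  - by rewrite ya ea; ring.
  - by rewrite yb eb; ring.
split=> // dimE.
have dimN : \dim (tangent_space (common_factor 1 l m.+1) y) = N.
  have -> : tangent_space (common_factor 1 l m.+1) y = fullv.
    apply/vspaceP => v; rewrite memvf; apply/mem_tangent_space.
    exact: full_tangent.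
  by rewrite dimvf /dim /= mul1n.
(* The tangent space has dimension N = 2 l + 2 m, which exceeds l + 2 m because [l] is positive. *)
have : (local_dim (common_factor 1 l m.+1) y <= l + (m + m))%N by apply: nat_supremum_le.
rewrite -dimE dimN; lia.
Qed.

End SecantLocus.

Theorem proposition3p5 (R : realType) (d : nat) (hd : (2 <= d)%N)
    (l : nat) (hl : (1 <= l)%N) :
  Sing d.-1 d.+1 (Sec R[i] d l) = Sec R[i] d l.+1.
Proof.
have chartE (p : 'I_d.-1 -> 'I_d.+1) q (pq : chart_index p q) m : d = (l + m)%N ->
    chart p q @^-1` Sec R[i] d l = common_factor p q hd 1 l m.
  move=> dlm; apply/seteqP; split=> y /=.
    by case/(Sec_chart hd pq) => m' dlm'; have -> : m' = m by lia.
  by move=> H; apply/(Sec_chart hd pq); exists m.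
apply/seteqP; split=> V.
  move=> [p [q [y [pq <- sing]]]].
  have [m dlm yX] : exists2 m, d = (l + m)%N & common_factor p q hd 1 l m y.
    by apply/(Sec_chart hd pq); case: sing.
  (* The case [m = 0] is empty, which leaves the form [m.+1] required by the criterion for singular
     points. *)
  case: m dlm yX => [|m] dlm yX; first by case: (common_factor_pos pq dlm yX).
  rewrite (chartE p q pq _ dlm) in sing.
  apply/(Sec_chart hd pq); exists m; first by rewrite dlm addnS.
  exact/(affine_singular_common_factor pq hl dlm yX).
move=> SV; have [p [q [y [pq Vy]]]] := chart_cover (SV.1 : \dim V = d.-1).
move: SV; rewrite -Vy => SV; exists p, q, y; split=> //.
have [m' dlm' yX'] := (Sec_chart hd pq l.+1 y).1 SV.
have [m dlm yX] := (Sec_chart hd pq l y).1 (conj SV.1 (ltnW SV.2)).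
have em : m = m'.+1 by lia.
rewrite {}em in dlm yX.
by rewrite (chartE p q pq _ dlm); apply/(affine_singular_common_factor pq hl dlm yX).
Qed.
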